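(* Let $R^4\subset\mathbb{P}^5$ be the image of $\mathbb{P}^1\times\mathbb{P}^1$ embedded by the complete linear system $|\mathcal{O}_{\mathbb{P}^1\times\mathbb{P}^1}(1,2)|$, and let $M_4\subset M_8^{14}\subset\mathbb{P}^{14}$ be the variety of secant and tangent lines of $R^4$. Then $M_4$ has degree $22$ (as a subvariety of $\mathbb{P}^{14}$).
   Context: Everything is over $\mathbb{C}$. $M_8^{14}\subset\mathbb{P}^{14}$ denotes the Grassmannian of lines in $\mathbb{P}^5$ in its Plücker embedding. $M_4$ is the set of all lines $\ell\subset\mathbb{P}^5$ that are chords of $R^4$ in the broad sense (secant or tangent), i.e. such that the scheme $\ell\cap R^4$ contains a subscheme of length $2$ (lines contained in $R^4$ included), with its reduced structure; it is a $4$-dimensional subvariety of $M_8^{14}$. Degree is with respect to the Plücker embedding. *)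

(* Defs.v *)
From HB Require Import structures.
From mathcomp Require Import all_boot all_order all_algebra.
From mathcomp Require Import reals.
From mathcomp Require Export complex.
From mathcomp Require Export mpoly.

Set Implicit Arguments.
Unset Strict Implicit.
Unset Printing Implicit Defensive.

Import GRing.Theory.
Local Open Scope ring_scope.

(** A point of P^n is given by a nonzero vector of homogeneous coordinates in
    'rV_n.+1, and a subset of P^n by a predicate on such vectors. These encodings are
    meant for an algebraically closed [K], where K-points suffice. *)

Section ProjectiveDegree.
Variables (K : fieldType) (n : nat).
Implicit Types (X : 'rV[K]_n.+1 -> Prop) (P : {poly rat}).

Definition vanishes_on X (f : {mpoly K[n.+1]}) : Prop :=
  forall x, X x -> f.@[x 0] = 0.

(** [h] is the value at [d] of the Hilbert function of [X] with its reduced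
    structure: [U] is the degree [d] part I_d of the homogeneous ideal of [X],
    and [h] is the dimension of K[x_0, ..., x_n]_d / I_d. *)
Definition hilbert_value X (d h : nat) : Prop :=
  exists U : {vspace dhomog n.+1 K d},
    (forall f : dhomog n.+1 K d, f \in U <-> vanishes_on X f)
    /\ (h + \dim U = \dim {: dhomog n.+1 K d})%N.

Definition is_hilbert_poly X P : Prop :=
  exists d0 : nat, forall d : nat, (d0 <= d)%N ->
    exists2 h : nat, hilbert_value X d h & P.[d%:R] = h%:R.

(** The degree of [X] is r! times the leading coefficient of its Hilbert
    polynomial, where r, the degree of that polynomial, is the dimension
    of [X]. *)
Definition has_degree X (e : nat) : Prop :=
  exists2 P, is_hilbert_poly X P
    & lead_coef P * ((size P).-1)`!%:R = e%:R.

End ProjectiveDegree.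

Section Lines.
Variables (K : fieldType) (n : nat).

(** A line of P^n is the row space of a matrix [L : 'M_(2, n.+1)] of rank 2;
    [line_param L] is the parametrization (a : b) |-> a L_0 + b L_1. *)
Definition line_param (L : 'M[K]_(2, n.+1)) : n.+1.-tuple {mpoly K[2]} :=
  [tuple \sum_(k < 2) L k i *: 'X_k | i < n.+1].

(** Via [line_param], a subscheme of length 2 of the line is the zero scheme of
    a nonzero binary quadratic form [q]; it is contained in [X] (with its
    reduced structure) iff [q] divides the restriction to the line of every
    homogeneous form vanishing on [X]. *)
Definition is_chord (X : 'rV[K]_n.+1 -> Prop) (L : 'M[K]_(2, n.+1)) : Prop :=
  exists q : {mpoly K[2]}, [/\ q != 0, q \is 2.-homog
    & forall (d : nat) (f : {mpoly K[n.+1]}),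
        f \is d.-homog -> vanishes_on X f ->
        exists g : {mpoly K[2]}, f \mPo (line_param L) = g * q].

End Lines.

Section Plucker.

Definition plucker_pairs : {set 'I_6 * 'I_6} :=
  [set ij : 'I_6 * 'I_6 | (ij.1 < ij.2)%N].

Lemma size_plucker_pairs : size (enum plucker_pairs) == 15%N.
Proof.
rewrite -cardE -sum1_card big_mkcond /=.
rewrite (eq_bigr (fun ij : 'I_6 * 'I_6 => nat_of_bool (ij.1 < ij.2)%N)).
  rewrite -(pair_bigA _ (fun i j : 'I_6 => nat_of_bool (i < j)%N)) /=.
  by rewrite !big_ord_recl !big_ord0 /=.
by move=> ij _; rewrite inE; case: (_ < _)%N.
Qed.

Definition plucker_index : 15.-tuple ('I_6 * 'I_6) := Tuple size_plucker_pairs.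

Variable K : fieldType.

Definition plucker (L : 'M[K]_(2, 6)) : 'rV[K]_15 :=
  \row_k let: (i, j) := tnth plucker_index k in
         L 0 i * L 1 j - L 0 j * L 1 i.

End Plucker.

Section Surface.
Variable K : fieldType.

(** Bihomogeneous of bidegree (a, b) in the variables X_0, X_1 and X_2, X_3,
    i.e. a section of O(a, b) on P^1 x P^1. *)
Definition bihomog (a b : nat) (f : {mpoly K[(2 + 2)]}) : Prop :=
  forall m, m \in msupp f ->
    (\sum_(i < 2) m (lshift 2 i) = a)%N /\ (\sum_(i < 2) m (rshift 2 i) = b)%N.

(** A choice of coordinates for the complete linear system |O(1,2)|: a basis of
    the space of bihomogeneous forms of bidegree (1, 2). *)
Definition basis_H0_1_2 (phi : 'I_6 -> {mpoly K[(2 + 2)]}) : Prop :=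
  (forall i, bihomog 1 2 (phi i)) /\
  (forall f, bihomog 1 2 f ->
     exists! c : 'rV[K]_6, f = \sum_i c 0 i *: phi i).

(** The image of P^1 x P^1 in P^5 under the map given by [phi]. *)
Definition R4 (phi : 'I_6 -> {mpoly K[(2 + 2)]}) (x : 'rV[K]_6) : Prop :=
  exists (s t : 'rV[K]_2) (k : K), [/\ s != 0, t != 0, k != 0
    & x = k *: \row_i (phi i).@[row_mx s t 0]].

(** The Plucker vectors of the chords; a change of basis of the line rescales
    its Plucker vector. *)
Definition M4 (phi : 'I_6 -> {mpoly K[(2 + 2)]}) (p : 'rV[K]_15) : Prop :=
  exists L : 'M[K]_(2, 6),
    [/\ \rank L = 2%N, is_chord (R4 phi) L & p = plucker L].

End Surface.

(* Main.v *)
From HB Require Import structures.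
Require Import Defs.
From mathcomp Require Import all_boot all_order all_algebra.
From mathcomp Require Import reals.
From mathcomp Require Import zify ring.

(** Let [x_i], [e] be the symmetric and antisymmetric bilinear forms in the second
    coordinates of a pair of points of P^1 x P^1, and [y_j], [d] those in the first
    coordinates. The Plücker coordinates of the chord through the two points span
    the 15 products [e x_i y_j] and [d x_i x_j]. So the degree n part of the
    coordinate ring of M_4 is the sum over k <= n of
    [e^(n-k) d^k Sym^(n+k)(x) Sym^(n-k)(y)]. By the relations
    [e^2 = x_1^2 - 4 x_0 x_2] and [y_1^2 = d^2 + 4 y_0 y_2] the products whose
    exponent of [y_1] is at most 1 already span; they are linearly independent, as
    those with the same parity of k have distinct leading monomials and exchanging
    the second coordinates of the points separates the parities. Hence the Hilbert
    function of M_4 is [sum_(k <= n) (2(n-k)+1) binom(n+k+2, 2)], a polynomial in n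
    with leading term [11/12 n^4 = 22 n^4/4!].

    A form in the Plücker coordinates vanishes on M_4 iff it vanishes identically on
    chords through two points. Indeed, R^4 is cut out by quadrics and the quadric
    defining the subscheme splits: for a double root the chord is a tangent line, and
    substituting the points [p] and [p + X p' + ...] over K[X] and dividing by a power
    of X shows that the form vanishes there too. *)

Set Implicit Arguments.
Unset Strict Implicit.
Unset Printing Implicit Defensive.

Import Order.TTheory GRing.Theory Num.Theory.
Local Open Scope ring_scope.

Local Notation "''i3_' k" := (@Ordinal 3 k isT) (at level 0, k at level 2).
Local Notation "''i6_' k" := (@Ordinal 6 k isT) (at level 0, k at level 2).
Local Notation "''i8_' k" := (@Ordinal 8 k isT) (at level 0, k at level 2).

(** * Linear independence from leading monomials *)

Section Independence.
Variables (n : nat) (K : idomainType).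

(** Distinct leading monomials cannot cancel: among the terms with nonzero coefficient the largest
    one survives in the sum. *)
Lemma mlead_free (I : eqType) (s : seq I) (c : I -> K) (F : I -> {mpoly K[n]}) :
    {in s, forall i, F i != 0} -> {in s &, injective (fun i => mlead (F i))} ->
    uniq s -> \sum_(i <- s) c i *: F i = 0 -> {in s, forall i, c i = 0}.
Proof.
move=> F0 injF us sum0 i0 i0s; apply/eqP/negPn/negP => ci0.
have i0s' : i0 \in [seq i <- s | c i != 0] by rewrite mem_filter ci0.
have us' : uniq [seq i <- s | c i != 0] by rewrite filter_uniq.
have sum0' : \sum_(i <- [seq i <- s | c i != 0]) c i *: F i = 0.
  rewrite big_filter -[RHS]sum0 [RHS](bigID (fun i => c i != 0)) /=.
  rewrite [X in _ + X]big1 ?addr0 // => i /negPn /eqP ->; exact: scale0r.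
have sub i : i \in [seq i <- s | c i != 0] -> c i != 0 /\ i \in s.
  by rewrite mem_filter => /andP.
move: sum0' sub i0s' us'.
set s' := [seq i <- s | c i != 0] => sum0' sub i0s' us'.
have := mlead_sum (r := s') (P := predT) (F := fun i => c i *: F i).
rewrite filter_predT sum0' mlead0 => H.
have lF i : i \in s' -> mlead (c i *: F i) = mlead (F i).
  by move=> /sub[ci _]; rewrite mleadZ.
have /H lead0 : uniq [seq mlead (c i *: F i) | i <- s'].
  rewrite map_inj_in_uniq // => i j is' js'; rewrite !lF //; apply: injF.
    by case: (sub _ is').
  by case: (sub _ js').
(* [mlead 0] is the monomial 1 by convention, so the vanishing sum is not yet a contradiction: it
   forces every remaining leading monomial to be 1, and injectivity leaves only [i0]. *)
have all0 i : i \in s' -> mlead (F i) = 0%MM.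
  move=> is'; rewrite -lF //.
  have /(_ isT) := joins_sup_seq (P := predT) (fun i => mlead (c i *: F i)) is'.
  by rewrite -lead0 lex0 => /eqP.
have eq0 i : i \in s' -> i = i0.
  move=> is'; apply: injF; rewrite ?all0 //; first by case: (sub _ is').
move: sum0'; rewrite (bigD1_seq i0) //= big1_seq ?addr0; last first.
  by move=> i /andP[ni /eq0 e]; rewrite e eqxx in ni.
move/eqP; rewrite -mul_mpolyC mulf_eq0 mpolyC_eq0 (negPf ci0) /=; apply/negP; exact: F0.
Qed.

End Independence.


(** * The forms [e], [d], [x_i], [y_j] and their products *)

(** [w] lists the coordinates [s0 s1 t0 t1] and [u0 u1 v0 v1] of two points of
    P^1 x P^1: [ee] and [xx] are the forms [e] and [x] in [t], [v], while [dd] and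
    [yy] are [d] and [y] in [s], [u]. *)
Section Family.
Variable A : comNzRingType.
Implicit Types w : 'I_8 -> A.
Definition ee w := w 'i8_2 * w 'i8_7 - w 'i8_3 * w 'i8_6.
Definition dd w := w 'i8_0 * w 'i8_5 - w 'i8_1 * w 'i8_4.
Definition xx w (j : 'I_3) := nth 0
  [:: w 'i8_2 * w 'i8_6; w 'i8_2 * w 'i8_7 + w 'i8_3 * w 'i8_6; w 'i8_3 * w 'i8_7] j.
Definition yy w (j : 'I_3) := nth 0
  [:: w 'i8_0 * w 'i8_4; w 'i8_0 * w 'i8_5 + w 'i8_1 * w 'i8_4; w 'i8_1 * w 'i8_5] j.
Definition fam w (a k x0 x1 x2 y0 y1 y2 : nat) :=
  ee w ^+ a * dd w ^+ k *
  (xx w 'i3_0 ^+ x0 * xx w 'i3_1 ^+ x1 * xx w 'i3_2 ^+ x2) *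
  (yy w 'i3_0 ^+ y0 * yy w 'i3_1 ^+ y1 * yy w 'i3_2 ^+ y2).
End Family.

Section Lead.
Variable K : idomainType.
Definition vX (i : 'I_8) : {mpoly K[8]} := 'X_i.

(* The monomial order is graded lexicographic with ['X_0] the largest variable. *)
Lemma mlead_bin (i j k l : 'I_8) (b : bool) : (i < j)%N -> (i < k)%N -> (i < l)%N ->
  mlead ('X_i * 'X_j + (-1) ^+ b *: ('X_k * 'X_l) : {mpoly K[8]}) =
  (U_(i) + U_(j))%MM.
Proof.
move=> ij ik il.
rewrite -!mpolyXD mleadDl ?mleadXm // mleadZ ?mleadXm ?signr_eq0 //.
apply/ltmcP; first by rewrite !mdegD !mdeg1.
exists i => [m mi|]; rewrite !mnmDE !mnm1E -!val_eqE /=.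
  case: i j k l m ij ik il mi => [i ?] [j ?] [k ?] [l ?] [m ?] /=.
  lia.
case: i j k l ij ik il => [i ?] [j ?] [k ?] [l ?] /=; lia.
Qed.

Let nz (p : {mpoly K[8]}) (m : 'X_{1..8}) : mlead p = m -> m != 0%MM -> p != 0.
Proof. by move=> <-; apply: contraNneq => ->; rewrite mlead0. Qed.

Let U2_neq0 (i j : 'I_8) : (U_(i) + U_(j))%MM != 0%MM :> 'X_{1..8}.
Proof. by rewrite -mdeg_eq0 mdegD !mdeg1. Qed.

Lemma mlead_ee : mlead (ee vX) = (U_('i8_2) + U_('i8_7))%MM.
Proof. by rewrite -(@mlead_bin _ _ 'i8_3 'i8_6 true) // expr1 scaleN1r. Qed.
Lemma mlead_dd : mlead (dd vX) = (U_('i8_0) + U_('i8_5))%MM.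
Proof. by rewrite -(@mlead_bin _ _ 'i8_1 'i8_4 true) // expr1 scaleN1r. Qed.
Lemma mlead_xx j : mlead (xx vX j) =
  (nth 0 [:: U_('i8_2) + U_('i8_6); U_('i8_2) + U_('i8_7); U_('i8_3) + U_('i8_7)] j)%MM.
Proof.
case: j => [[|[|[|//]]] ?]; rewrite ?/xx ?/yy /=; rewrite /vX; try by rewrite -mpolyXD mleadXm.
by rewrite -(@mlead_bin _ _ 'i8_3 'i8_6 false) // expr0 scale1r.
Qed.
Lemma mlead_yy j : mlead (yy vX j) =
  (nth 0 [:: U_('i8_0) + U_('i8_4); U_('i8_0) + U_('i8_5); U_('i8_1) + U_('i8_5)] j)%MM.
Proof.
case: j => [[|[|[|//]]] ?]; rewrite ?/xx ?/yy /=; rewrite /vX; try by rewrite -mpolyXD mleadXm.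
by rewrite -(@mlead_bin _ _ 'i8_1 'i8_4 false) // expr0 scale1r.
Qed.
Lemma ee_neq0 : ee vX != 0. Proof. exact: nz mlead_ee _. Qed.
Lemma dd_neq0 : dd vX != 0. Proof. exact: nz mlead_dd _. Qed.
Lemma xx_neq0 j : xx vX j != 0.
Proof. by apply: nz (mlead_xx j) _; case: j => [[|[|[|//]]] ?]; apply: U2_neq0. Qed.
Lemma yy_neq0 j : yy vX j != 0.
Proof. by apply: nz (mlead_yy j) _; case: j => [[|[|[|//]]] ?]; apply: U2_neq0. Qed.
Definition nzE := (ee_neq0, dd_neq0, xx_neq0, yy_neq0).
Lemma fam_neq0 a k x0 x1 x2 y0 y1 y2 : fam vX a k x0 x1 x2 y0 y1 y2 != 0.
Proof. by rewrite /fam !mulf_neq0 ?expf_neq0 ?nzE. Qed.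

Let mlead_fam0 (e d p0 p1 p2 q0 q1 q2 : {mpoly K[8]}) a k x0 x1 x2 y0 y1 y2 :
  e != 0 -> d != 0 -> p0 != 0 -> p1 != 0 -> p2 != 0 -> q0 != 0 -> q1 != 0 -> q2 != 0 ->
  mlead (e ^+ a * d ^+ k * (p0 ^+ x0 * p1 ^+ x1 * p2 ^+ x2) *
         (q0 ^+ y0 * q1 ^+ y1 * q2 ^+ y2)) =
  (mlead e *+ a + mlead d *+ k +
    (mlead p0 *+ x0 + mlead p1 *+ x1 + mlead p2 *+ x2) +
    (mlead q0 *+ y0 + mlead q1 *+ y1 + mlead q2 *+ y2))%MM.
Proof. by move=> *; rewrite !(mleadM, mleadX) ?(mulf_neq0, expf_neq0). Qed.

(** [ee] and the middle [xx] share a leading monomial, and so do [dd] and the middle [yy]. So only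
    the sums [a + x1] and [k + y1] are visible, besides the other four exponents. *)
Lemma mlead_fam a k x0 x1 x2 y0 y1 y2 (m := mlead (fam vX a k x0 x1 x2 y0 y1 y2)) :
  [/\ [/\ m 'i8_0 = k + y0 + y1, m 'i8_1 = y2, m 'i8_4 = y0 & m 'i8_5 = k + y1 + y2]%N &
   [/\ m 'i8_2 = a + x0 + x1, m 'i8_3 = x2, m 'i8_6 = x0 & m 'i8_7 = a + x1 + x2]%N].
Proof.
rewrite /m /fam mlead_fam0 ?nzE // mlead_ee mlead_dd !mlead_xx !mlead_yy /=.
by do 2!split; rewrite !(mnmDE, mulmnE, mnm1E) -!val_eqE /=; lia.
Qed.
End Lead.

(** [(k, ((x0, x2), (b, y0)))] stands for the product in which [d] has exponent [k],
    [x_0], [x_2] and [y_0] have exponents [x0], [x2] and [y0], and [y_1] has exponent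
    [b]; the remaining exponents are determined by the degrees. *)
Section Indices.

Definition basis_index : Type := nat * ((nat * nat) * (bool * nat)).

Definition triangle n : seq (nat * nat) :=
  [seq (i, j) | i <- iota 0 n.+1, j <- iota 0 (n - i).+1].

Definition strip m : seq (bool * nat) :=
  [seq (false, j) | j <- iota 0 m.+1] ++ [seq (true, j) | j <- iota 0 m].

Definition indices d : seq basis_index :=
  [seq (k, p) | k <- iota 0 d.+1,
                p <- [seq (p1, p2) | p1 <- triangle (d + k), p2 <- strip (d - k)]].

Lemma mem_triangle n i j : ((i, j) \in triangle n) = (i + j <= n)%N.
Proof.
apply/allpairsPdep/idP => [[a [b [+ + [-> ->]]]]|ij].
  by rewrite !mem_iota; lia.
by exists i, j; rewrite !mem_iota; split=> //; lia.
Qed.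

Lemma mem_strip m b j : ((b, j) \in strip m) = (b + j <= m)%N.
Proof.
rewrite mem_cat; apply/orP/idP => [[]/mapP[a + [-> ->]]|].
- by rewrite mem_iota.
- by rewrite mem_iota.
by case: b => bj; [right|left]; apply: map_f; rewrite mem_iota.
Qed.

Lemma mem_indices d k i j b l : ((k, ((i, j), (b, l))) \in indices d) =
  [&& k <= d, i + j <= d + k & b + l <= d - k]%N.
Proof.
apply/allpairsPdep/and3P => [[k' [p [+ + [-> e]]]]|[kd ij bl]].
  rewrite -e => + /allpairsP[[p1 p2] /= [+ + [e1 e2]]].
  by rewrite -e1 -e2 mem_triangle mem_strip mem_iota => *; split; lia.
exists k, ((i, j), (b, l)); split=> //; first by rewrite mem_iota; lia.
by apply/allpairsP; exists ((i, j), (b, l)); rewrite mem_triangle mem_strip.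
Qed.

Lemma uniq_indices d : uniq (indices d).
Proof.
apply: allpairs_uniq_dep; first exact: iota_uniq; last first.
  by move=> [k p] [k' p'] _ _ /= [-> ->].
move=> k _; apply: allpairs_uniq; last by move=> [p q] [p' q'] _ _ /= [-> ->].
- apply: allpairs_uniq_dep; first exact: iota_uniq.
    by move=> i _; apply: iota_uniq.
  by move=> [i j] [i' j'] _ _ /= [-> ->].
rewrite cat_uniq !map_inj_uniq ?iota_uniq; try by move=> ? ? [].
by rewrite andbT; apply/hasPn => x /mapP[j _ ->]; apply/negP => /mapP[? _ []].
Qed.

Lemma size_triangle n : (2 * size (triangle n) = n.+1 * n.+2)%N.
Proof.
rewrite size_allpairs_dep (eq_map (g := fun i => (n - i).+1)); last first.
  by move=> i; rewrite size_iota.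
rewrite sumnE big_map -[iota 0 n.+1]/(index_iota 0 n.+1).
rewrite big_nat_rev /= add0n.
rewrite (eq_big_nat _ _ (F2 := fun i => i.+1)); last by move=> i; lia.
elim: n => [|n IH]; first by rewrite big_nat1.
by rewrite big_nat_recr //= mulnDr IH; lia.
Qed.

Lemma size_strip m : size (strip m) = (2 * m).+1.
Proof. by rewrite size_cat !size_map !size_iota; lia. Qed.

Lemma size_indices d :
  (2 * size (indices d) =
   \sum_(0 <= k < d.+1) (2 * (d - k)).+1 * ((d + k).+1 * (d + k).+2))%N.
Proof.
rewrite size_allpairs_dep sumnE big_map big_distrr.
apply: eq_bigr => k _; rewrite size_allpairs size_strip.
by rewrite -[LHS]/(2 * (size (triangle (d + k)) * (2 * (d - k)).+1))%N mulnA size_triangle mulnC.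
Qed.

End Indices.

(** The degrees [d - k] in [ee] and [yy], [k] in [dd] and [d + k] in [xx] are those of a degree [d]
    form in Plücker coordinates: in each point it has degree [d] in the first coordinates and
    [2 * d] in the second. On [indices d] no subtraction is truncated. *)
Definition bas (A : comNzRingType) (w : 'I_8 -> A) d (i : basis_index) : A :=
  let: (k, ((x0, x2), (b, y0))) := i in
  fam w (d - k) k x0 (d + k - x0 - x2) x2 y0 b (d - k - b - y0).

Lemma fam_morph (A B : comNzRingType) (f : {rmorphism A -> B}) w a k x0 x1 x2 y0 y1 y2 :
  f (fam w a k x0 x1 x2 y0 y1 y2) = fam (f \o w) a k x0 x1 x2 y0 y1 y2.
Proof. by rewrite /fam /ee /dd /xx /yy /= !(rmorphM, rmorphXn, rmorphB, rmorphD). Qed.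

(** * Linear independence of the products *)

Section Free.
Variable K : idomainType.
Hypothesis two_neq0 : (2 : K) != 0.

(** Exchanges the second coordinates of the two points; among the forms only [ee] changes, by a
    sign. *)
Definition swap8 (i : 'I_8) : 'I_8 :=
  nth i [:: 'i8_0; 'i8_1; 'i8_6; 'i8_7; 'i8_4; 'i8_5; 'i8_2; 'i8_3] i.

Lemma fam_swap (A : comNzRingType) (w : 'I_8 -> A) a k x0 x1 x2 y0 y1 y2 :
  fam (w \o swap8) a k x0 x1 x2 y0 y1 y2 =
  (-1) ^+ a * fam w a k x0 x1 x2 y0 y1 y2.
Proof.
have -> : fam (w \o swap8) a k x0 x1 x2 y0 y1 y2 =
  (- ee w) ^+ a * dd w ^+ k *
  (xx w 'i3_0 ^+ x0 * xx w 'i3_1 ^+ x1 * xx w 'i3_2 ^+ x2) *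
  (yy w 'i3_0 ^+ y0 * yy w 'i3_1 ^+ y1 * yy w 'i3_2 ^+ y2).
  rewrite /fam /ee /dd /xx /yy /=; congr (_ ^+ _ * _ * (_ ^+ _ * _ ^+ _ * _ ^+ _) * _);
    rewrite /swap8 /=; ring.
by rewrite [(- ee w) ^+ a]exprNn /fam !mulrA.
Qed.

(** Recovers the exponents of [dd] and of the middle [yy] from their sum, the only trace they leave
    in the leading monomial. *)
Lemma odd_bool_inj k k' (b b' : bool) :
  odd k = odd k' -> (k + b = k' + b')%N -> k = k' /\ b = b'.
Proof.
move=> o e; suff bb : b = b' by split=> //; apply: (@addIn b); rewrite e bb.
by apply: (@addbI (odd k)); rewrite {2}o -[b]oddb -[b']oddb -!oddD e.
Qed.

Lemma mlead_bas d k x0 x2 b y0 m :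
  m = mlead (bas (@vX K) d (k, ((x0, x2), (b, y0)))) ->
  [/\ m 'i8_0 = k + y0 + b, m 'i8_4 = y0, m 'i8_3 = x2 & m 'i8_6 = x0]%N.
Proof. move=> ->.
by have [[-> _ -> _] [_ -> -> _]] :=
  mlead_fam K (d - k) k x0 (d + k - x0 - x2) x2 y0 b (d - k - b - y0). Qed.

Lemma bas_free d (c : basis_index -> K) :
  \sum_(i <- indices d) c i *: bas (@vX K) d i = 0 ->
  {in indices d, forall i, c i = 0}.
Proof.
move=> sum0.
have sumP : \sum_(i <- indices d) (-1) ^+ (d - i.1) * c i *: bas (@vX K) d i = 0.
  pose f : {rmorphism {mpoly K[8]} -> {mpoly K[8]}} :=
    comp_mpoly [tuple vX K (swap8 i) | i < 8].
  have := congr1 f sum0; rewrite raddf0 raddf_sum /=; apply: etrans.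
  apply: eq_bigr => -[k [[x0 x2] [b y0]]] _ /=.
  rewrite comp_mpolyZ -[_ \mPo _]/(f _) fam_morph.
  have -> : fam (f \o vX K) (d - k) k x0 (d + k - x0 - x2) x2 y0 b (d - k - b - y0)
    = fam (vX K \o swap8) (d - k) k x0 (d + k - x0 - x2) x2 y0 b (d - k - b - y0).
    have e i : (f \o vX K) i = (vX K \o swap8) i.
      by rewrite /f /= comp_mpolyXU -tnth_nth tnth_mktuple.
    by rewrite /fam /ee /dd /xx /yy !e.
  rewrite fam_swap -scalerA -signr_odd -[in RHS]signr_odd.
  by case: odd; rewrite ?expr0 ?expr1 ?scale1r ?mul1r ?scaleN1r ?mulN1r ?scalerN.
(* Exchanging [t] and [v] multiplies the product by [(-1) ^+ (d - k)]. *)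
have parity r : \sum_(i <- [seq i <- indices d | odd (d - i.1) == r])
    c i *: bas (@vX K) d i = 0.
  apply: (mulfI (x := 2%:R)); first by rewrite -mpolyC_nat mpolyC_eq0.
  (* Adding [(-1) ^+ r] times the exchanged relation doubles the terms of parity [r] and cancels the
     others. *)
  have : \sum_(i <- indices d) c i *: bas (@vX K) d i + (-1) ^+ r *
    \sum_(i <- indices d) (-1) ^+ (d - i.1) * c i *: bas (@vX K) d i = 0.
    by rewrite sum0 sumP mulr0 addr0.
  rewrite mulr0 big_filter; apply: etrans.
  rewrite !mulr_sumr -big_split big_mkcond /=.
  apply: eq_bigr => i _; rewrite -[(-1) ^+ (d - i.1)]signr_odd.
  by case: (odd _); case: r => /=;
    rewrite ?(expr0, expr1, mul1r, mulN1r, scaleNr, opprK); ring.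
move=> i id; apply: (mlead_free _ _ _ (parity (odd (d - i.1)))).
- by move=> [k [[x0 x2] [b y0]]] _; apply: fam_neq0.
- move=> [k [[x0 x2] [b y0]]] [k' [[x0' x2'] [b' y0']]].
  rewrite !mem_filter /= !mem_indices => /andP[/eqP pk /and3P[h1 h2 h3]].
  move=> /andP[/eqP pk' /and3P[h1' h2' h3']] /= e.
  have [e0 e2 e5 e6] :=
    mlead_bas (erefl (mlead (bas (@vX K) d (k, ((x0, x2), (b, y0))))));
  have [f0 f2 f5 f6] := mlead_bas e; clear e.
  have odd_kk' : odd k = odd k'.
    by move: pk; rewrite -pk' !oddB // => /addbI.
  have kbE : (k + b = k' + b')%N.
    by apply/eqP; rewrite -(eqn_add2r y0) addnAC -e0 f0 -e2 f2 addnAC.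
  have [kE bE] : k = k' /\ b = b' by apply: odd_bool_inj.
  by rewrite kE bE -e2 f2 -e6 f6 -e5 f5.
- by rewrite filter_uniq ?uniq_indices.
by rewrite mem_filter eqxx.
Qed.
End Free.

(** * Homogeneous components of the coordinate ring *)

Section StandardCoordinates.
Variable A : comNzRingType.

(** The standard monomial basis of bidegree (1, 2): coordinate [3 * a + b] is s_a times the b-th
    quadratic monomial in [t0], [t1]. *)
Definition veronese (s0 s1 t0 t1 : A) (i : 'I_6) : A :=
  nth 0 [:: s0; s1] (i %/ 3) * nth 0 [:: t0 * t0; t0 * t1; t1 * t1] (i %% 3).

Definition point1 (w : 'I_8 -> A) := veronese (w 'i8_0) (w 'i8_1) (w 'i8_2) (w 'i8_3).
Definition point2 (w : 'I_8 -> A) := veronese (w 'i8_4) (w 'i8_5) (w 'i8_6) (w 'i8_7).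
Definition minor2 (x y : 'I_6 -> A) i j := x i * y j - x j * y i.

End StandardCoordinates.

Section Span.
Variable K : fieldType.
Let X := vX K.

Definition in_span d (p : {mpoly K[8]}) : Prop :=
  exists c : basis_index -> K, p = \sum_(i <- indices d) c i *: bas X d i.

Lemma in_span0 d : in_span d 0.
Proof. by exists (fun=> 0); rewrite big1 // => i _; rewrite scale0r. Qed.

Lemma in_spanD d p q : in_span d p -> in_span d q -> in_span d (p + q).
Proof.
move=> [c ->] [c' ->]; exists (fun i => c i + c' i).
by rewrite -big_split; apply: eq_bigr => i _; rewrite scalerDl.
Qed.

Lemma in_spanZ d a p : in_span d p -> in_span d (a *: p).
Proof.
move=> [c ->]; exists (fun i => a * c i).
by rewrite scaler_sumr; apply: eq_bigr => i _; rewrite scalerA.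
Qed.

Lemma in_spanN d p : in_span d p -> in_span d (- p).
Proof. by rewrite -scaleN1r; apply: in_spanZ. Qed.

Lemma in_span_sum d (I : Type) (r : seq I) (P : pred I) F :
  (forall i, P i -> in_span d (F i)) -> in_span d (\sum_(i <- r | P i) F i).
Proof.
move=> h; elim/big_ind: _ => //; [exact: in_span0 | by move=> *; apply: in_spanD].
Qed.

Lemma in_span_bas d i : i \in indices d -> in_span d (bas X d i).
Proof.
move=> id; exists (fun j => (j == i)%:R).
rewrite (bigD1_seq i) ?uniq_indices //= eqxx scale1r big1 ?addr0 //.
by move=> j /negPf ->; rewrite scale0r.
Qed.

Lemma ee_sqr (A : comNzRingType) (w : 'I_8 -> A) :
  ee w ^+ 2 = xx w 'i3_1 ^+ 2 - 4%:R * (xx w 'i3_0 * xx w 'i3_2).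
Proof. by rewrite /ee /xx /=; ring. Qed.

Lemma yy_sqr (A : comNzRingType) (w : 'I_8 -> A) :
  yy w 'i3_1 ^+ 2 = dd w ^+ 2 + 4%:R * (yy w 'i3_0 * yy w 'i3_2).
Proof. by rewrite /dd /yy /=; ring. Qed.

(** y_1^2 becomes d^2 + 4 y_0 y_2; in the term with d^2 also e^2 is replaced, so that the exponents
    of e and d keep their sum. *)
Lemma fam_reduce (A : comNzRingType) (w : 'I_8 -> A) a k x0 x1 x2 y0 y1 y2 :
  fam w a.+2 k x0 x1 x2 y0 y1.+2 y2 =
  fam w a k.+2 x0 x1.+2 x2 y0 y1 y2
    - 4%:R * fam w a k.+2 x0.+1 x1 x2.+1 y0 y1 y2
    + 4%:R * fam w a.+2 k x0 x1 x2 y0.+1 y1 y2.+1.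
Proof.
have := ee_sqr w; have := yy_sqr w; rewrite /fam.
move: (ee w) (dd w) (xx w) (yy w) => e d x y hy he.
have -> : e ^+ a.+2 = e ^+ a * e ^+ 2 by rewrite -exprD addn2.
have -> : y 'i3_1 ^+ y1.+2 = y 'i3_1 ^+ y1 * y 'i3_1 ^+ 2 by rewrite -exprD addn2.
have -> : d ^+ k.+2 = d ^+ k * d ^+ 2 by rewrite -exprD addn2.
have -> : x 'i3_1 ^+ x1.+2 = x 'i3_1 ^+ x1 * x 'i3_1 ^+ 2 by rewrite -exprD addn2.
by rewrite hy he !exprS expr0 mulr1; ring.
Qed.

Lemma in_span_fam a k x0 x1 x2 y0 y1 y2 :
  (x0 + x1 + x2 = a + k + k)%N -> (y0 + y1 + y2 = a)%N ->
  in_span (a + k) (fam X a k x0 x1 x2 y0 y1 y2).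
Proof.
have [n le_y1n] := ubnP y1.
elim: n y1 le_y1n a k x0 x1 x2 y0 y2 => // n IH [|[|y1]] le_y1n a k x0 x1 x2 y0 y2 ex ey.
- have /in_span_bas : (k, ((x0, x2), (false, y0))) \in indices (a + k).
    by rewrite mem_indices /=; apply/and3P; split; lia.
  rewrite /bas addnK.
  have -> : (a + k + k - x0 - x2 = x1)%N by lia.
  by have -> : (a - false - y0 = y2)%N by lia.
- have /in_span_bas : (k, ((x0, x2), (true, y0))) \in indices (a + k).
    by rewrite mem_indices /=; apply/and3P; split; lia.
  rewrite /bas addnK.
  have -> : (a + k + k - x0 - x2 = x1)%N by lia.
  by have -> : (a - true - y0 = y2)%N by lia.
(* The total degree in y is [a], so an exponent of y_1 at least 2 makes the factor e^2 available for
   [fam_reduce]. *)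
case: a ex ey => [|[|a]] ex ey; [lia | lia |].
rewrite fam_reduce -[4%:R](rmorph_nat (@mpolyC 8 K)) !mul_mpolyC.
apply: in_spanD; [apply: in_spanD; last apply/in_spanN/in_spanZ | apply: in_spanZ].
- by rewrite !addSnnS; apply: IH; lia.
- by rewrite !addSnnS; apply: IH; lia.
by apply: IH; lia.
Qed.

Lemma fam_mul (A : comNzRingType) (w : 'I_8 -> A) a k x0 x1 x2 y0 y1 y2
    a' k' x0' x1' x2' y0' y1' y2' :
  fam w a k x0 x1 x2 y0 y1 y2 * fam w a' k' x0' x1' x2' y0' y1' y2' =
  fam w (a + a') (k + k') (x0 + x0') (x1 + x1') (x2 + x2')
    (y0 + y0') (y1 + y1') (y2 + y2').
Proof. by rewrite /fam !exprD; ring. Qed.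

(** A product of two basis elements may contain y_1^2, hence the appeal to [in_span_fam]. *)
Lemma in_spanM d d' p q : in_span d p -> in_span d' q -> in_span (d + d') (p * q).
Proof.
move=> [c ->] [c' ->]; rewrite mulr_suml; rewrite big_seq; apply: in_span_sum => i id.
rewrite mulr_sumr big_seq; apply: in_span_sum => j jd.
rewrite -scalerAl -scalerAr; do 2![apply: in_spanZ].
move: i j id jd => [k [[x0 x2] [b y0]]] [k' [[x0' x2'] [b' y0']]].
rewrite !mem_indices => /and3P[h1 h2 h3] /and3P[h1' h2' h3'].
have -> : (d + d' = (d - k + (d' - k')) + (k + k'))%N by lia.
by rewrite /bas fam_mul; apply: in_span_fam; lia.
Qed.

Lemma in_span1 : in_span 0 1.
Proof.
have -> : 1 = fam X 0 0 0 0 0 0 0 0 by rewrite /fam !expr0 !mulr1.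
exact: in_span_fam.
Qed.

Lemma in_span_exx i j : in_span 1 (ee X * xx X i * yy X j).
Proof.
have -> : ee X * xx X i * yy X j =
  fam X 1 0 (val i == 0)%N (val i == 1)%N (val i == 2)%N (val j == 0)%N (val j == 1)%N (val j == 2)%N.
  case: i j => -[|[|[|//]]] ? [[|[|[|//]]]] ?; rewrite /fam /= !(expr0, expr1, mul1r, mulr1); reflexivity.
case: i j => -[|[|[|//]]] ? [[|[|[|//]]]] ?; exact: (@in_span_fam 1 0).
Qed.

Lemma in_span_dxx i j : in_span 1 (dd X * (xx X i * xx X j)).
Proof.
have -> : dd X * (xx X i * xx X j) =
  fam X 0 1 ((val i == 0)%N + (val j == 0)%N) ((val i == 1)%N + (val j == 1)%N)
     ((val i == 2)%N + (val j == 2)%N) 0 0 0.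
  case: i j => -[|[|[|//]]] ? [[|[|[|//]]]] ?; rewrite /fam /= !(expr0, expr1, mul1r, mulr1, expr2);
   first [reflexivity | congr (_ * _); rewrite mulrC; reflexivity].
case: i j => -[|[|[|//]]] ? [[|[|[|//]]]] ?; exact: (@in_span_fam 0 1).
Qed.

Let S1 a : {mpoly K[8]} := nth 0 [:: X 'i8_0; X 'i8_1] a.
Let S2 a : {mpoly K[8]} := nth 0 [:: X 'i8_4; X 'i8_5] a.
Let T1 b : {mpoly K[8]} := nth 0 [:: X 'i8_2 * X 'i8_2; X 'i8_2 * X 'i8_3; X 'i8_3 * X 'i8_3] b.
Let T2 b : {mpoly K[8]} := nth 0 [:: X 'i8_6 * X 'i8_6; X 'i8_6 * X 'i8_7; X 'i8_7 * X 'i8_7] b.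

Let in_span_symS q a b : (forall j, in_span 1 (q * yy X j)) -> (a < 2)%N -> (b < 2)%N ->
  in_span 1 (q * (S1 a * S2 b + S1 b * S2 a)).
Proof.
move=> hq; have [h0 h1 h2] := And3 (hq 'i3_0) (hq 'i3_1) (hq 'i3_2).
case: a => [|[|//]] _; case: b => [|[|//]] _.
- by rewrite mulrDr; apply: in_spanD.
- exact: h1.
- by rewrite addrC; exact: h1.
by rewrite mulrDr; apply: in_spanD.
Qed.

Let in_span_altT a b j : (a < 3)%N -> (b < 3)%N ->
  in_span 1 ((T1 a * T2 b - T1 b * T2 a) * yy X j).
Proof.
have h i := in_span_exx i j; have hN i := in_spanN (h i).
case: a => [|[|[|//]]] _; case: b => [|[|[|//]]] _;
  rewrite ?subrr ?mul0r; try exact: in_span0.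
- by move: (h 'i3_0); congr in_span; rewrite /T1 /T2 /ee /xx /=; ring.
- by move: (h 'i3_1); congr in_span; rewrite /T1 /T2 /ee /xx /=; ring.
- by move: (hN 'i3_0); congr in_span; rewrite /T1 /T2 /ee /xx /=; ring.
- by move: (h 'i3_2); congr in_span; rewrite /T1 /T2 /ee /xx /=; ring.
- by move: (hN 'i3_1); congr in_span; rewrite /T1 /T2 /ee /xx /=; ring.
- by move: (hN 'i3_2); congr in_span; rewrite /T1 /T2 /ee /xx /=; ring.
Qed.

Let in_span_symT a b : (a < 3)%N -> (b < 3)%N ->
  in_span 1 (dd X * (T1 a * T2 b + T1 b * T2 a)).
Proof.
have h := in_span_dxx; have h2 i j := in_spanD (h i j) (h i j).
case: a => [|[|[|//]]] _; case: b => [|[|[|//]]] _.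
- by move: (h2 'i3_0 'i3_0); congr in_span; rewrite /T1 /T2 /xx /dd /=; ring.
- by move: (h 'i3_0 'i3_1); congr in_span; rewrite /T1 /T2 /xx /dd /=; ring.
(* (t_0 v_1)^2 + (t_1 v_0)^2 = x_1^2 - 2 x_0 x_2. *)
- by move: (in_spanD (h 'i3_1 'i3_1) (in_spanN (h2 'i3_0 'i3_2)));
    congr in_span; rewrite /T1 /T2 /xx /dd /=; ring.
- by move: (h 'i3_0 'i3_1); congr in_span; rewrite /T1 /T2 /xx /dd /=; ring.
- by move: (h2 'i3_0 'i3_2); congr in_span; rewrite /T1 /T2 /xx /dd /=; ring.
- by move: (h 'i3_1 'i3_2); congr in_span; rewrite /T1 /T2 /xx /dd /=; ring.
- by move: (in_spanD (h 'i3_1 'i3_1) (in_spanN (h2 'i3_0 'i3_2)));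
    congr in_span; rewrite /T1 /T2 /xx /dd /=; ring.
- by move: (h 'i3_1 'i3_2); congr in_span; rewrite /T1 /T2 /xx /dd /=; ring.
- by move: (h2 'i3_2 'i3_2); congr in_span; rewrite /T1 /T2 /xx /dd /=; ring.
Qed.

(** The second exterior power of a tensor product S (x) T splits into tensors alternating in T and
    symmetric in S, and the reverse. The first kind is divisible by [ee], the second by [dd]. The
    splitting requires halving. *)
Lemma in_span_minor i j : (2 : K) != 0 -> in_span 1 (minor2 (point1 X) (point2 X) i j).
Proof.
move=> two_neq0.
rewrite -[minor2 _ _ _ _]scale1r -(mulVf two_neq0) -scalerA; apply: in_spanZ.
rewrite -mul_mpolyC rmorph_nat.
have -> : 2%:R * minor2 (point1 X) (point2 X) i j =
    (T1 (i %% 3) * T2 (j %% 3) - T1 (j %% 3) * T2 (i %% 3)) *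
    (S1 (i %/ 3) * S2 (j %/ 3) + S1 (j %/ 3) * S2 (i %/ 3)) +
    (S1 (i %/ 3) * S2 (j %/ 3) - S1 (j %/ 3) * S2 (i %/ 3)) *
    (T1 (i %% 3) * T2 (j %% 3) + T1 (j %% 3) * T2 (i %% 3)).
  rewrite /minor2 /point1 /point2 /veronese.
  rewrite -/(S1 _) -/(S1 _) -/(S2 _) -/(S2 _) -/(T1 _) -/(T1 _) -/(T2 _) -/(T2 _).
  ring.
have lt2 (k : 'I_6) : (k %/ 3 < 2)%N by rewrite ltn_divLR.
apply: in_spanD.
  by apply: in_span_symS => // l; apply: in_span_altT; rewrite ltn_mod.
have hT := @in_span_symT (i %% 3) (j %% 3) (@ltn_pmod i 3 isT) (@ltn_pmod j 3 isT).
move: (lt2 i) (lt2 j) hT; move: (T1 _ * _ + _) => T.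
case: (i %/ 3)%N => [|[|//]] _; case: (j %/ 3)%N => [|[|//]] _ hT.
- by rewrite subrr mul0r; apply: in_span0.
- exact: hT.
- by move: (in_spanN hT); congr in_span; rewrite /S1 /S2 /dd /=; ring.
by rewrite subrr mul0r; apply: in_span0.
Qed.

(** * Forms of degree [d] in a given tuple of polynomials *)

Section Image.
Variables (N : nat) (g : N.-tuple {mpoly K[8]}).

Definition in_image d (p : {mpoly K[8]}) : Prop :=
  exists2 f : {mpoly K[N]}, f \is d.-homog & p = f \mPo g.

Lemma in_imageD d p q : in_image d p -> in_image d q -> in_image d (p + q).
Proof. by move=> [f hf ->] [f' hf' ->]; exists (f + f'); rewrite ?rpredD ?comp_mpolyD. Qed.

Lemma in_imageZ d a p : in_image d p -> in_image d (a *: p).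
Proof. by move=> [f hf ->]; exists (a *: f); rewrite ?rpredZ ?comp_mpolyZ. Qed.

Lemma in_imageN d p : in_image d p -> in_image d (- p).
Proof. by rewrite -scaleN1r; apply: in_imageZ. Qed.

Lemma in_image0 d : in_image d 0.
Proof. by exists 0; rewrite ?rpred0 ?comp_mpoly0. Qed.

Lemma in_image_sum d (I : Type) (r : seq I) F :
  (forall i, in_image d (F i)) -> in_image d (\sum_(i <- r) F i).
Proof.
by move=> h; elim/big_ind: _ => //; [exact: in_image0 | move=> *; apply: in_imageD].
Qed.

Lemma in_imageM d d' p q : in_image d p -> in_image d' q -> in_image (d + d') (p * q).
Proof.
move=> [f hf ->] [f' hf' ->]; exists (f * f'); first exact: dhomogM.
by rewrite -[RHS]/(comp_mpoly g _) rmorphM.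
Qed.

Lemma in_image1 : in_image 0 1.
Proof. by exists 1; rewrite ?dhomog1 ?comp_mpoly1. Qed.

Lemma in_image_gen k : in_image 1 (tnth g k).
Proof.
by exists 'X_k; [rewrite dhomogX /= mdeg1 | rewrite comp_mpolyXU -tnth_nth].
Qed.

Lemma image_in_span d p :
  (forall k, in_span 1 (tnth g k)) -> in_image d p -> in_span d p.
Proof.
move=> hg [f hf ->]; rewrite comp_mpolyE big_seq; apply: in_span_sum => m mf.
apply: in_spanZ; have <- := dhomog_mf hf mf; rewrite /= mdegE.
elim/big_ind2: _ => [||k _]; first exact: in_span1; first by move=> *; apply: in_spanM.
elim: (m k) => [|n IH]; first exact: in_span1.
by rewrite exprS -add1n; exact: in_spanM (hg k) IH.
Qed.

(** The degree conditions allow each factor e to be grouped with one x and one y, and each factor d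
    with two x. *)
Lemma fam_in_image a k x0 x1 x2 y0 y1 y2 :
    (forall i j, in_image 1 (ee X * xx X i * yy X j)) ->
    (forall i j, in_image 1 (dd X * (xx X i * xx X j))) ->
    (x0 + x1 + x2 = a + k + k)%N -> (y0 + y1 + y2 = a)%N ->
  in_image (a + k) (fam X a k x0 x1 x2 y0 y1 y2).
Proof.
move=> he hd ex ey.
have hD l s : size s = (l + l)%N ->
    in_image l (dd X ^+ l * \prod_(i <- s) xx X i).
  elim: l s => [|l IH] s.
    by move/size0nil => ->; rewrite big_nil expr0 mulr1; apply: in_image1.
  case: s => [|i [|j s]] //; rewrite addSn addnS // => -[ss].
  rewrite !big_cons exprS -add1n.
  by move: (in_imageM (hd i j) (IH s ss)); congr in_image; ring.
have hE r s : size s = (size r + k + k)%N ->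
    in_image (size r + k) (ee X ^+ size r * dd X ^+ k *
       \prod_(i <- s) xx X i * \prod_(j <- r) yy X j).
  elim: r s => [|j r IH] s; last case: s => // i s.
    move=> ss; move: (hD k s ss); congr in_image.
    by rewrite [in RHS]big_nil expr0 mul1r mulr1.
  move=> -[ss]; rewrite !big_cons /= exprS addSn -add1n.
  by move: (in_imageM (he i j) (IH s ss)); congr in_image; ring.
pose s := nseq x0 'i3_0 ++ nseq x1 'i3_1 ++ nseq x2 'i3_2.
pose r := nseq y0 'i3_0 ++ nseq y1 'i3_1 ++ nseq y2 'i3_2.
have sr : size r = a by rewrite !size_cat !size_nseq addnA.
have ss : size s = (size r + k + k)%N by rewrite sr -ex !size_cat !size_nseq addnA.
have prod_nseq n i (z : 'I_3 -> {mpoly K[8]}) : \prod_(j <- nseq n i) z j = z i ^+ n.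
  by rewrite big_nseq -Monoid.iteropE.
move: (hE _ _ ss); rewrite sr; congr in_image.
by rewrite /fam /s /r !big_cat /= !prod_nseq !mulrA.
Qed.
End Image.
End Span.

(** * Plücker coordinates of the generic chord *)

Section Coordinates.
Variable K : fieldType.
Let X := vX K.

Definition lin_comb (V : lmodType K) (G : 'M[K]_6) (x : 'I_6 -> V) i : V :=
  \sum_j G j i *: x j.

Lemma lin_combM (V : lmodType K) (G H : 'M[K]_6) (x : 'I_6 -> V) i :
  lin_comb H (lin_comb G x) i = lin_comb (G *m H) x i.
Proof.
rewrite /lin_comb; under eq_bigr do rewrite scaler_sumr.
rewrite exchange_big /=; apply: eq_bigr => j _; rewrite mxE scaler_suml.
by apply: eq_bigr => k _; rewrite scalerA mulrC.
Qed.

Lemma lin_comb1 (V : lmodType K) (x : 'I_6 -> V) i : lin_comb 1%:M x i = x i.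
Proof.
rewrite /lin_comb (bigD1 i) //= mxE eqxx scale1r big1 ?addr0 // => j ji.
by rewrite mxE (negPf ji) scale0r.
Qed.

Lemma minor2_lin_comb (A : comAlgType K) (G : 'M[K]_6) (x y : 'I_6 -> A) i j :
  minor2 (lin_comb G x) (lin_comb G y) i j =
  \sum_k \sum_l (G k i * G l j) *: minor2 x y k l.
Proof.
have prodE a b u v : (\sum_k G k a *: u k) * (\sum_l G l b *: v l) =
    \sum_k \sum_l (G k a * G l b) *: (u k * v l) :> A.
  rewrite mulr_suml; apply: eq_bigr => k _; rewrite mulr_sumr.
  by apply: eq_bigr => l _; rewrite -scalerAl -scalerAr scalerA.
rewrite /minor2 /lin_comb !prodE [X in _ - X]exchange_big -sumrB.
apply: eq_bigr => k _; rewrite -sumrB; apply: eq_bigr => l _.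
by rewrite scalerBr [G l j * _]mulrC.
Qed.

(** The Plücker vector of the line through two generic points of the surface, [G] being the change
    from the monomial basis to the chosen one. *)
Definition chord_form (G : 'M[K]_6) : 15.-tuple {mpoly K[8]} :=
  [tuple let: (i, j) := tnth plucker_index k in
     minor2 (lin_comb G (point1 X)) (lin_comb G (point2 X)) i j | k < 15].

Lemma chord_form_in_span G k : (2 : K) != 0 -> in_span 1 (tnth (chord_form G) k).
Proof.
move=> two_neq0; rewrite tnth_mktuple; case: (tnth plucker_index k) => i j; rewrite minor2_lin_comb.
do 2![apply: in_span_sum => ? _]; apply: in_spanZ; exact: in_span_minor.
Qed.

Lemma minor_in_image_coord G i j : in_image (chord_form G) 1
  (minor2 (lin_comb G (point1 X)) (lin_comb G (point2 X)) i j).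
Proof.
have lt_case (a b : 'I_6) : (a < b)%N -> in_image (chord_form G) 1
    (minor2 (lin_comb G (point1 X)) (lin_comb G (point2 X)) a b).
  move=> ab; have /tnthP[k ek] : (a, b) \in plucker_index.
    by rewrite mem_enum inE.
  by have := in_image_gen (chord_form G) k; rewrite tnth_mktuple -ek.
case: (ltngtP i j) => [||/val_inj <-].
- exact: lt_case.
- by move=> /lt_case /in_imageN; congr in_image; rewrite /minor2 opprB.
by rewrite /minor2 subrr; apply: in_image0.
Qed.

(** [invmx G] undoes the change of coordinates, and minors transform linearly. *)
Lemma minor_in_image G i j : G \in unitmx ->
  in_image (chord_form G) 1 (minor2 (point1 X) (point2 X) i j).
Proof.
move=> uG.
have e x a : x a = lin_comb (invmx G) (lin_comb G x) a :> {mpoly K[8]}.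
  by rewrite lin_combM mulmxV // lin_comb1.
have -> : minor2 (point1 X) (point2 X) i j = minor2
  (lin_comb (invmx G) (lin_comb G (point1 X)))
  (lin_comb (invmx G) (lin_comb G (point2 X))) i j.
  by congr (_ * _ - _ * _); exact: e.
rewrite minor2_lin_comb; do 2![apply: in_image_sum => ?].
apply: in_imageZ; exact: minor_in_image_coord.
Qed.

(** Inverts the splitting behind [in_span_minor]. The pair of t-monomials selects x_i; equal
    s-indices give y_0 or y_2, and a combination symmetric in the s-indices gives y_1. *)
Lemma exx_in_image G i j : G \in unitmx ->
  in_image (chord_form G) 1 (ee X * xx X i * yy X j).
Proof.
move=> uG; have h := fun i j => @minor_in_image G i j uG.
case: i j => -[|[|[|//]]] ? [[|[|[|//]]]] ?.
- by move: (h 'i6_0 'i6_1); congr in_image;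
    rewrite /ee /dd /xx /yy /minor2 /point1 /point2 /veronese /=; ring.
- by move: (in_imageD (h 'i6_0 'i6_4) (in_imageN (h 'i6_1 'i6_3))); congr in_image;
    rewrite /ee /dd /xx /yy /minor2 /point1 /point2 /veronese /=; ring.
- by move: (h 'i6_3 'i6_4); congr in_image;
    rewrite /ee /dd /xx /yy /minor2 /point1 /point2 /veronese /=; ring.
- by move: (h 'i6_0 'i6_2); congr in_image;
    rewrite /ee /dd /xx /yy /minor2 /point1 /point2 /veronese /=; ring.
- by move: (in_imageD (h 'i6_0 'i6_5) (in_imageN (h 'i6_2 'i6_3))); congr in_image;
    rewrite /ee /dd /xx /yy /minor2 /point1 /point2 /veronese /=; ring.
- by move: (h 'i6_3 'i6_5); congr in_image;
    rewrite /ee /dd /xx /yy /minor2 /point1 /point2 /veronese /=; ring.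
- by move: (h 'i6_1 'i6_2); congr in_image;
    rewrite /ee /dd /xx /yy /minor2 /point1 /point2 /veronese /=; ring.
- by move: (in_imageD (h 'i6_1 'i6_5) (in_imageN (h 'i6_2 'i6_4))); congr in_image;
    rewrite /ee /dd /xx /yy /minor2 /point1 /point2 /veronese /=; ring.
- by move: (h 'i6_4 'i6_5); congr in_image;
    rewrite /ee /dd /xx /yy /minor2 /point1 /point2 /veronese /=; ring.
Qed.

Lemma dxx_in_image G i j : G \in unitmx ->
  in_image (chord_form G) 1 (dd X * (xx X i * xx X j)).
Proof.
move=> uG; have h := fun i j => @minor_in_image G i j uG.
case: i j => -[|[|[|//]]] ? [[|[|[|//]]]] ?.
- by move: (h 'i6_0 'i6_3); congr in_image;
    rewrite /ee /dd /xx /yy /minor2 /point1 /point2 /veronese /=; ring.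
- by move: (in_imageD (h 'i6_0 'i6_4) (h 'i6_1 'i6_3)); congr in_image;
    rewrite /ee /dd /xx /yy /minor2 /point1 /point2 /veronese /=; ring.
- by move: (h 'i6_1 'i6_4); congr in_image;
    rewrite /ee /dd /xx /yy /minor2 /point1 /point2 /veronese /=; ring.
- by move: (in_imageD (h 'i6_0 'i6_4) (h 'i6_1 'i6_3)); congr in_image;
    rewrite /ee /dd /xx /yy /minor2 /point1 /point2 /veronese /=; ring.
(* x_1^2 = (t_0 v_1)^2 + (t_1 v_0)^2 + 2 t_0 t_1 v_0 v_1; the last term accounts for the repeated
   minor. *)
- by move: (in_imageD (in_imageD (h 'i6_0 'i6_5) (h 'i6_2 'i6_3)) (in_imageD (h 'i6_1 'i6_4) (h 'i6_1 'i6_4))); congr in_image;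
    rewrite /ee /dd /xx /yy /minor2 /point1 /point2 /veronese /=; ring.
- by move: (in_imageD (h 'i6_1 'i6_5) (h 'i6_2 'i6_4)); congr in_image;
    rewrite /ee /dd /xx /yy /minor2 /point1 /point2 /veronese /=; ring.
- by move: (h 'i6_1 'i6_4); congr in_image;
    rewrite /ee /dd /xx /yy /minor2 /point1 /point2 /veronese /=; ring.
- by move: (in_imageD (h 'i6_1 'i6_5) (h 'i6_2 'i6_4)); congr in_image;
    rewrite /ee /dd /xx /yy /minor2 /point1 /point2 /veronese /=; ring.
- by move: (h 'i6_2 'i6_5); congr in_image;
    rewrite /ee /dd /xx /yy /minor2 /point1 /point2 /veronese /=; ring.
Qed.

Lemma bas_in_image G d i : G \in unitmx -> i \in indices d ->
  in_image (chord_form G) d (bas X d i).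
Proof.
move=> uG; case: i => [k [[x0 x2] [b y0]]]; rewrite mem_indices => /and3P[h1 h2 h3].
rewrite -{1}(subnK h1) /bas; apply: fam_in_image; try lia.
- by move=> i j; apply: exx_in_image.
by move=> i j; apply: dxx_in_image.
Qed.
End Coordinates.

(** * The Hilbert polynomial *)

Section HilbertPolynomial.

(** The expansion of the sum of (2(d-k)+1) binom(d+k+2, 2) over k <= d, lowest coefficient first. *)
Definition hilbert_poly22 : {poly rat} :=
  Poly [:: 1; 23%:R / 6%:R; 67%:R / 12%:R; 11%:R / 3%:R; 11%:R / 12%:R].

(** The bound [n] is kept apart from [D] to allow induction. The summand is (a - 2k)(k^2 + bk + c),
    and the right side combines the sums of k^3, k^2, k and 1. *)
Lemma partial_sum (D : rat) n :
  \sum_(0 <= k < n) (2 * (D - k%:R) + 1) * ((D + k%:R + 1) * (D + k%:R + 2)) =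
  let a := 2 * D + 1 in let b := 2 * D + 3 in let c := (D + 1) * (D + 2) in
  let m : rat := n%:R in
  - 2 * (m * (m - 1) / 2) ^+ 2 + (a - 2 * b) * (m * (m - 1) * (2 * m - 1) / 6%:R)
  + (a * b - 2 * c) * (m * (m - 1) / 2) + a * c * m.
Proof.
elim: n => [|n IH]; first by rewrite big_geq //=; field.
by rewrite big_nat_recr //= IH -natr1 /=; field.
Qed.

Lemma hilbert_poly22E d : hilbert_poly22.[d%:R] = (size (indices d))%:R.
Proof.
apply: (@mulfI _ 2) => //; rewrite -natrM size_indices natr_sum.
have -> : \sum_(0 <= k < d.+1) ((2 * (d - k)).+1 * ((d + k).+1 * (d + k).+2))%N%:R =
  \sum_(0 <= k < d.+1) (2 * (d%:R - k%:R) + 1) * ((d%:R + k%:R + 1) * (d%:R + k%:R + 2)) :> rat.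
  apply: eq_big_nat => k /andP[_ kd].
  by rewrite !natrM -!natr1 natrM natrB // !natrD; ring.
by rewrite partial_sum horner_Poly /= -natr1; field.
Qed.

Lemma hilbert_poly22_lead :
  lead_coef hilbert_poly22 * ((size hilbert_poly22).-1)`!%:R = 22%:R.
Proof. by rewrite lead_coefE /hilbert_poly22 (@PolyK _ 0). Qed.

End HilbertPolynomial.

(** [B] may be infinite dimensional, so [f] is replaced by its coordinates in the basis [f (F i)] of
    its range. This linear map [g] onto ['rV_h] has the same kernel, and rank-nullity applies. *)
Lemma kernel_dim (K : fieldType) (V : vectType K) (B : lmodType K)
    (f : {linear V -> B}) h (F : 'I_h -> V) :
    (forall v, exists c : 'rV[K]_h, f v = \sum_i c 0 i *: f (F i)) ->
    (forall c : 'rV[K]_h, \sum_i c 0 i *: f (F i) = 0 -> c = 0) ->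
  exists U : {vspace V}, (forall v, v \in U <-> f v = 0) /\ (h + \dim U = \dim {:V})%N.
Proof.
move=> gen free.
pose S (c : 'rV[K]_h) := \sum_i c 0 i *: f (F i).
have SP a c c' : S (a *: c + c') = a *: S c + S c'.
  rewrite /S scaler_sumr -big_split; apply: eq_bigr => i _ /=.
  by rewrite !mxE scalerDl scalerA.
have S_inj : injective S.
  move=> c c' e; apply/eqP; rewrite -subr_eq0 -[_ - _]addrC -scaleN1r; apply/eqP/free.
  by rewrite -/(S _) SP e scaleN1r addNr.
have ex v : exists c, f v == S c by have [c ->] := gen v; exists c.
pose g v := xchoose (ex v).
have gS v : S (g v) = f v by apply/esym/eqP/(xchooseP (ex v)).
have g_lin : linear g by move=> a u v; apply: S_inj; rewrite SP !gS linearP.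
pose gl : {linear V -> 'rV[K]_h} := HB.pack g (GRing.isLinear.Build _ _ _ _ g g_lin).
exists (lker (linfun gl)); split=> [v|].
  rewrite memv_ker lfunE /= -gS; split=> [/eqP ->|fv0].
    by rewrite /S big1 // => i _; rewrite mxE scale0r.
  by apply/eqP; apply: free.
have := limg_ker_dim (linfun gl) fullv; rewrite capfv addnC => <-; congr (_ + _)%N.
have -> : (linfun gl @: fullv)%VS = fullv.
  apply/eqP; rewrite eqEsubv subvf; apply/subvP => c _.
  have -> : c = linfun gl (\sum_i c 0 i *: F i).
    rewrite lfunE /=; apply: S_inj; rewrite gS linear_sum /=.
    by apply: eq_bigr => i _; rewrite linearZ.
  by rewrite memv_img ?memvf.
by rewrite dimvf /dim /= mul1n.
Qed.

(** * Forms vanishing on M_4 *)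

(** The first [size p] natural numbers are distinct roots, more than a nonzero [p] can have. *)
Lemma poly_vanish (K : numDomainType) (p : {poly K}) : (forall x, p.[x] = 0) -> p = 0.
Proof.
move=> p0; apply/eqP/negPn/negP => pn0.
have := max_poly_roots (rs := [seq (i%:R : K) | i <- iota 0 (size p)]) pn0.
rewrite size_map size_iota ltnn => h; suff: false by [].
apply: h; first by apply/allP => x _; rewrite /root p0.
by rewrite map_inj_uniq ?iota_uniq // => i j /eqP; rewrite eqr_nat => /eqP.
Qed.

(** Induction on the number of variables: [muni] turns [p] into a polynomial in the last variable,
    whose coefficients vanish everywhere by [poly_vanish]. *)
Lemma mpoly_vanish (K : numDomainType) n (p : {mpoly K[n]}) :
  (forall v, p.@[v] = 0) -> p = 0.
Proof.
elim: n p => [|n IH] p p0.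
  have m0 (m : 'X_{1..0}) : m = 0%MM by apply/mnmP => -[].
  have pC : p = (p@_0)%:MP.
    by apply/mpolyP => m; rewrite [m]m0 mcoeffC eqxx mulr1.
  by have := p0 (fun=> 0); rewrite pC mevalC => ->; rewrite mpolyC0.
have coef0 k : (muni p)`_k = 0.
  apply: IH => v; rewrite -(coef_map (meval v)).
  suff -> : map_poly (meval v) (muni p) = 0 by rewrite coef0.
  apply: poly_vanish => x.
  pose w (i : 'I_n.+1) := if unlift ord_max i is Some j then v j else x.
  rewrite -[RHS](p0 w) muniE mevalE raddf_sum horner_sum; apply: eq_bigr => m _ /=.
  rewrite map_polyZ /= hornerZ mevalZ mevalX map_polyXn hornerXn -mulrA big_ord_recr.
  rewrite /w unlift_none; congr (_ * (_ * _)); apply: eq_bigr => i _.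
  have wE : widen_ord (leqnSn n) i = lift ord_max i.
    by apply: val_inj; rewrite /= /bump leqNgt ltn_ord.
  by rewrite mnmE wE liftK.
apply/mpolyP => m; rewrite mcoeff0.
have := congr1 (mcoeff [multinom m (widen_ord (leqnSn n) i) | i < n]) (coef0 (m ord_max)).
rewrite mcoeff0 => <-; rewrite muniE coef_sum raddf_sum /= {1}[p]mpolyE raddf_sum.
apply: eq_bigr => m' _ /=; rewrite mcoeffZ mcoeffX coefZ coefXn.
rewrite mulr_natr mcoeffMn mcoeffZ mcoeffX -mulrnAr -mulrnA mulnb.
congr (_ * (nat_of_bool _)%:R); apply/eqP/andP => [->|[/eqP/mnmP e /eqP e']]; first by rewrite !eqxx.
apply/mnmP => i; case: (unliftP ord_max i) => [j ->|-> //].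
have -> : lift ord_max j = widen_ord (leqnSn n) j.
  by apply: val_inj; rewrite /= /bump leqNgt ltn_ord.
by have := e j; rewrite !mnmE.
Qed.

Lemma mmap_homog (K S : comNzRingType) (h : {rmorphism K -> S}) n d
    (f : {mpoly K[n]}) (c : S) v :
  f \is d.-homog -> mmap h (fun i => c * v i) f = c ^+ d * mmap h v f.
Proof.
move=> hf; rewrite /mmap mulr_sumr big_seq [RHS]big_seq; apply: eq_bigr => m mf.
rewrite mulrCA; congr (_ * _); rewrite /mmap1 -(dhomog_mf hf mf) /= mdegE.
under eq_bigr do rewrite exprMn.
by rewrite big_split prodrXr.
Qed.

Lemma mmap_comp (K S : comNzRingType) (h : {rmorphism K -> S}) n k
    (f : {mpoly K[n]}) (g : n.-tuple {mpoly K[k]}) v :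
  mmap h v (f \mPo g) = mmap h (fun i => mmap h v (tnth g i)) f.
Proof.
rewrite comp_mpolyE raddf_sum; apply: eq_bigr => m _ /=.
rewrite mmapZ rmorph_prod; congr (_ * _).
by apply: eq_bigr => i _; rewrite rmorphXn.
Qed.

Lemma comp_homog (K : comNzRingType) n k d e (f : {mpoly K[n]})
    (g : n.-tuple {mpoly K[k]}) :
  (forall i, tnth g i \is e.-homog) -> f \is d.-homog -> f \mPo g \is (e * d).-homog.
Proof.
move=> hg hf; rewrite comp_mpolyE big_seq; apply: rpred_sum => m mf.
apply: rpredZ; rewrite -(dhomog_mf hf mf) /= mdegE big_distrr /=.
elim/big_ind2: _ => [||i _]; first exact: dhomog1; first by move=> *; apply: dhomogM.
exact: dhomogMn.
Qed.

Lemma divisible_X0X1 (K : comNzRingType) d (F : {mpoly K[2]}) (i0 i1 : 'I_2) :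
  i0 != i1 -> F \is d.-homog ->
  F.@[fun i => (i == i0)%:R] = 0 -> F.@[fun i => (i == i1)%:R] = 0 ->
  exists g, F = g * ('X_i0 * 'X_i1).
Proof.
move=> i01 hF F0 F1.
(* At the i-th coordinate point a form takes as value the coefficient of its pure power of ['X_i],
   the only monomial free of ['X_j]. *)
have pos i j m : i != j -> F.@[fun k => (k == i)%:R] = 0 -> m \in msupp F -> (0 < m j)%N.
  move=> ij Fi mF; rewrite lt0n; apply/eqP => mj0.
  have or_ij k : k = i \/ k = j.
    by case: i j k ij {Fi mj0} => -[|[|//]] ? [[|[|//]] ?] [[|[|//]] ?] //= _;
      solve [left; exact: val_inj | right; exact: val_inj].
  have mdeg2 m' : mdeg m' = (m' i + m' j)%N.
    rewrite mdegE (bigD1 i) //= (bigD1 j) 1?eq_sym //= big1 ?addn0 // => k /andP[ki kj].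
    by case: (or_ij k) ki kj => ->; rewrite eqxx.
  move: (mF); rewrite mcoeff_msupp => /negP; apply; rewrite -Fi mevalE.
  rewrite (bigD1_seq m) ?msupp_uniq //= [X in _ + X]big1_seq => [|m' /andP[m'm m'F]].
    rewrite addr0 big1 ?mulr1 // => k _.
    by case: (or_ij k) => ->; rewrite ?eqxx ?expr1n // mj0 expr0.
  have m'j : m' j != 0%N.
    apply: contraNneq m'm => m'j0; apply/eqP/mnmP => k.
    have := dhomog_mf hF mF; have := dhomog_mf hF m'F; rewrite /= !mdeg2 mj0 m'j0 !addn0.
    by move=> e' e; case: (or_ij k) => ->; rewrite ?e ?e' ?mj0 ?m'j0.
  by rewrite (bigD1 j) //= eq_sym (negPf ij) expr0n (negPf m'j) mul0r mulr0.
exists (\sum_(m <- msupp F) F@_m *: 'X_[m - U_(i0) - U_(i1)]).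
rewrite {1}[F]mpolyE mulr_suml big_seq [RHS]big_seq; apply: eq_bigr => m mF.
rewrite -scalerAl -!mpolyXD; congr (_ *: 'X_[_]).
apply/mnmP => i; rewrite !mnmDE !mnmBE !mnm1E.
have := pos i1 i0 m; rewrite eq_sym i01 => /(_ isT F1 mF) p0.
have := pos i0 i1 m i01 F0 mF => p1.
have [e0|n0] := eqVneq i0 i; have [e1|n1] := eqVneq i1 i.
- by rewrite e0 e1 eqxx in i01.
- by rewrite -e0 /=; lia.
- by rewrite -e1 /=; lia.
by rewrite !subn0 !addn0.
Qed.

(** * Bases of the forms of bidegree (1, 2) *)

Section Basis.
Variable K : fieldType.

Definition monomial12 : 'I_6 -> {mpoly K[2 + 2]} :=
  veronese 'X_(lshift 2 ord0) 'X_(lshift 2 ord_max) 'X_(rshift 2 ord0) 'X_(rshift 2 ord_max).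

Lemma ord2E (i : 'I_2) : i = ord0 \/ i = ord_max.
Proof. by case: i => -[|[|//]] ?; [left|right]; apply: val_inj. Qed.

Lemma mpolyX_bihomog (m : 'X_{1..2 + 2}) :
  (\sum_(i < 2) m (lshift 2 i) = 1)%N -> (\sum_(i < 2) m (rshift 2 i) = 2)%N ->
  exists j, 'X_[m] = monomial12 j.
Proof.
rewrite !big_ord_recl !big_ord0 !addn0 /=.
have -> : lift ord0 ord0 = ord_max :> 'I_2 by apply: val_inj.
move=> h1 h2.
(* The position in [veronese]: its quotient and remainder by 3 are the exponents of the second
   variable of each factor. *)
have lt6 : (m (lshift 2 ord_max) * 3 + m (rshift 2 ord_max) < 6)%N by lia.
exists (Ordinal lt6); rewrite mpolyXE_id big_split_ord /=.
rewrite !big_ord_recl !big_ord0 !mulr1 /=.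
have -> : lift ord0 ord0 = ord_max :> 'I_2 by apply: val_inj.
have r3 : (m (rshift 2 ord_max) < 3)%N by lia.
rewrite /monomial12 /veronese /= divnMDl // divn_small // addn0 modnMDl modn_small //.
have -> : m (lshift 2 ord0) = (1 - m (lshift 2 ord_max))%N by lia.
have -> : m (rshift 2 ord0) = (2 - m (rshift 2 ord_max))%N by lia.
have : (m (lshift 2 ord_max) < 2)%N by lia.
case: (m (lshift 2 ord_max)) => [|[|//]] _; move: r3;
  case: (m (rshift 2 ord_max)) => [|[|[|//]]] _ /=; rewrite ?subn0 ?subnn ?expr0 ?expr1 ?expr2 ?mul1r ?mulr1 //=.
Qed.

Lemma monomial12_bihomog j : bihomog 1 2 (monomial12 j).
Proof.
suff [m -> [h1 h2]] : exists2 m, monomial12 j = 'X_[m] &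
    (\sum_(i < 2) m (lshift 2 i) = 1)%N /\ (\sum_(i < 2) m (rshift 2 i) = 2)%N.
  by move=> m'; rewrite msuppX inE => /eqP ->.
have [] : (j %/ 3 < 2)%N /\ (j %% 3 < 3)%N by rewrite ltn_divLR // ltn_mod.
rewrite /monomial12 /veronese; case: (j %/ 3)%N => [|[|//]] _; case: (j %% 3)%N => [|[|[|//]]] _;
 rewrite /= -!mpolyXD; refine (ex_intro2 _ _ _ erefl _).
all: rewrite !big_ord_recl !big_ord0 !mnmDE !mnm1E; by split; rewrite -!val_eqE.
Qed.

Lemma monomial12_span f : bihomog 1 2 f ->
  exists c : 'I_6 -> K, f = \sum_j c j *: monomial12 j.
Proof.
move=> hf; rewrite [f]mpolyE.
have : {subset msupp f <= msupp f} by [].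
move: {1 3}(msupp f) => s; elim: s => [|m s IH] sf.
  by exists (fun=> 0); rewrite big_nil big1 // => j _; rewrite scale0r.
have [|c ec] := IH; first by move=> x xs; apply: sf; rewrite inE xs orbT.
have [h1 h2] := hf m (sf m (mem_head _ _)).
have [j ej] := mpolyX_bihomog h1 h2.
exists (fun i => f@_m *+ (i == j) + c i).
rewrite big_cons ec ej; under [RHS]eq_bigr do rewrite scalerDl.
rewrite big_split; congr (_ + _); rewrite (bigD1 j) //= eqxx mulr1n big1 ?addr0 // => i ij.
by rewrite (negPf ij) mulr0n scale0r.
Qed.

(** Each basis is expanded in the other; the two matrices are inverse because coordinates in [phi]
    are unique. *)
Lemma basis_coords phi : basis_H0_1_2 phi ->
  exists2 G : 'M[K]_6, G \in unitmx & forall i, phi i = lin_comb G monomial12 i.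
Proof.
move=> [phih phiu].
have [g hg] := fin_all_exists (fun i => monomial12_span (phih i)).
have [c hc] := fin_all_exists (fun j : 'I_6 => phiu _ (@monomial12_bihomog j)).
pose G : 'M[K]_6 := \matrix_(j, i) g i j; pose C : 'M[K]_6 := \matrix_(i, j) c j 0 i.
have phiG i : phi i = lin_comb G monomial12 i.
  by rewrite [LHS]hg; apply: eq_bigr => j _; rewrite mxE.
have monC j : monomial12 j = lin_comb C phi j.
  have [e _] := hc j; rewrite [LHS]e /lin_comb.
  by apply: eq_bigr => i _; rewrite mxE.
exists G => //.
have CG1 : C *m G = 1%:M.
  (* Column [j] of [C *m G] and the j-th unit vector are both coordinates of [phi j]. *)
  apply/matrixP => i j; have [d [_ du]] := phiu _ (phih j).
  have e1 : d = \row_k (C *m G) k j.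
    apply: du; rewrite [LHS]phiG; transitivity (lin_comb (C *m G) phi j); last first.
      by apply: eq_bigr => k _; rewrite !mxE.
    by rewrite -lin_combM; apply: eq_bigr => k _; rewrite monC.
  have e2 : d = \row_k (k == j)%:R.
    apply: du; rewrite (bigD1 j) //= mxE eqxx scale1r big1 ?addr0 // => k kj.
    by rewrite mxE (negPf kj) scale0r.
  by have /rowP/(_ i) := etrans (esym e1) e2; rewrite !mxE.
by have [] := mulmx1_unit CG1.
Qed.
End Basis.

Lemma veronese_morph (A B : comNzRingType) (h : {rmorphism A -> B}) s0 s1 t0 t1 i :
  h (veronese s0 s1 t0 t1 i) = veronese (h s0) (h s1) (h t0) (h t1) i.
Proof.
rewrite /veronese rmorphM.
have [] : (i %/ 3 < 2)%N /\ (i %% 3 < 3)%N by rewrite ltn_divLR // ltn_mod.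
case: (i %/ 3)%N => [|[|//]] _; case: (i %% 3)%N => [|[|[|//]]] _ /=; by rewrite rmorphM.
Qed.

Lemma minor2_morph (A B : comNzRingType) (h : {rmorphism A -> B}) (x y : 'I_6 -> A) i j :
  h (minor2 x y i j) = minor2 (h \o x) (h \o y) i j.
Proof. by rewrite /minor2 rmorphB !rmorphM. Qed.

Lemma line_param_eval (K : fieldType) n (L : 'M[K]_(2, n.+1)) i v :
  (tnth (line_param L) i).@[v] = \sum_k L k i * v k.
Proof.
by rewrite tnth_mktuple raddf_sum; apply: eq_bigr => k _ /=; rewrite mevalZ mevalXU.
Qed.

Lemma line_param_homog (K : fieldType) n (L : 'M[K]_(2, n.+1)) i :
  tnth (line_param L) i \is 1.-homog.
Proof.
by rewrite tnth_mktuple; apply: rpred_sum => k _; rewrite rpredZ // dhomogX /= mdeg1.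
Qed.

Lemma det_mx2 (A : comNzRingType) (M : 'M[A]_2) : \det M = M 0 0 * M 1 1 - M 0 1 * M 1 0.
Proof.
rewrite (expand_det_row _ 0) !big_ord_recl big_ord0 addr0 /cofactor !det_mx11 !mxE /=.
have -> : lift 0 0 = 1 :> 'I_2 by apply: val_inj.
have -> : lift 1 0 = 0 :> 'I_2 by apply: val_inj.
by rewrite /= expr0 expr1 mul1r mulN1r mulrN.
Qed.

(** * Lines through two points of the surface *)

Section Chords.
Variable K : fieldType.
Variables (phi : 'I_6 -> {mpoly K[2 + 2]}) (G : 'M[K]_6).
Hypothesis uG : G \in unitmx.
Hypothesis phiG : forall i, phi i = lin_comb G (@monomial12 K) i.

Lemma phi_eval (s t : 'rV[K]_2) : \row_i (phi i).@[row_mx s t 0] =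
  (\row_j veronese (s 0 ord0) (s 0 ord_max) (t 0 ord0) (t 0 ord_max) j) *m G.
Proof.
apply/rowP => i; rewrite !mxE phiG raddf_sum; apply: eq_bigr => j _ /=.
rewrite mevalZ mxE mulrC; congr (_ * _).
rewrite [LHS](veronese_morph (meval _)) /= !mevalXU.
by rewrite !(row_mxEl, row_mxEr).
Qed.

Definition chord_matrix (w : 'I_8 -> K) : 'M[K]_(2, 6) :=
  \matrix_(i, j) (if i == 0 then point1 w j else point2 w j).

Lemma chord_form_eval w k :
  (tnth (chord_form G) k).@[w] = plucker (chord_matrix w *m G) 0 k.
Proof.
rewrite tnth_mktuple mxE; case: (tnth plucker_index k) => i j.
rewrite [LHS](minor2_morph (meval w)) /minor2 /=.
have e x a : (lin_comb G x a).@[w] = \sum_b (x b).@[w] * G b a.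
  by rewrite raddf_sum; apply: eq_bigr => b _ /=; rewrite mevalZ mulrC.
have e1 a : (lin_comb G (point1 (vX K)) a).@[w] = (chord_matrix w *m G) 0 a.
  rewrite e mxE; apply: eq_bigr => b _; rewrite mxE eqxx /point1.
  by rewrite [X in X * _](veronese_morph (meval w)) /= !mevalXU.
have e2 a : (lin_comb G (point2 (vX K)) a).@[w] = (chord_matrix w *m G) 1 a.
  rewrite e mxE; apply: eq_bigr => b _; rewrite mxE /point2.
  by rewrite [X in X * _](veronese_morph (meval w)) /= !mevalXU.
by congr (_ * _ - _ * _); [exact: e1 | exact: e2 | exact: e1 | exact: e2].
Qed.

(** Where this minor is nonzero, both parameter pairs give actual points of P^1 x P^1 and the two
    image points are distinct. *)
Lemma minor2_01 (A : comNzRingType) (w : 'I_8 -> A) :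
  minor2 (point1 w) (point2 w) 'i6_0 'i6_1 =
  w 'i8_0 * w 'i8_2 * (w 'i8_4 * w 'i8_6) * ee w.
Proof. by rewrite /minor2 /point1 /point2 /veronese /ee /=; ring. Qed.

Lemma chord_rank w : minor2 (point1 w) (point2 w) 'i6_0 'i6_1 != 0 ->
  \rank (chord_matrix w *m G) = 2%N.
Proof.
move=> m0; rewrite mxrankMfree ?row_free_unit //.
(* [S] selects the first two columns, whose determinant is the minor assumed nonzero. *)
pose S : 'M[K]_(6, 2) := \matrix_(i, j) (val i == val j)%:R.
have NS : chord_matrix w *m S = \matrix_(i, j) chord_matrix w i (widen_ord (isT : 2 <= 6)%N j).
  apply/matrixP => i j; rewrite !mxE (bigD1 (widen_ord (isT : 2 <= 6)%N j)) //= !mxE eqxx mulr1.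
  by rewrite big1 ?addr0 // => k kj; rewrite mxE -val_eqE /= in kj *; rewrite mxE (negPf kj) mulr0.
have uNS : chord_matrix w *m S \in unitmx.
  by rewrite NS unitmxE unitfE det_mx2 !mxE /=; move: m0; congr (_ != 0).
apply/eqP; rewrite eqn_leq rank_leq_row /=.
by apply: leq_trans (mxrankM_maxl _ S); rewrite mxrank_unit.
Qed.

Lemma chord_R4 w i : minor2 (point1 w) (point2 w) 'i6_0 'i6_1 != 0 ->
  R4 phi (row i (chord_matrix w *m G)).
Proof.
rewrite minor2_01 !mulf_eq0 !negb_or -!andbA => /and5P[w0 w2 w4 w6 _].
have mk (a b : K) : a != 0 -> (\row_j (if j == ord0 :> 'I_2 then a else b)) != 0.
  move=> a0; apply: contraNneq a0 => /rowP/(_ ord0); rewrite !mxE /= => ->; exact: eqxx.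
case: (ord2E i) => ->.
  exists (\row_j (if j == ord0 then w 'i8_0 else w 'i8_1)).
  exists (\row_j (if j == ord0 then w 'i8_2 else w 'i8_3)), 1.
  rewrite scale1r phi_eval oner_neq0 !mk //; split=> //.
  by rewrite row_mul; congr (_ *m _); apply/rowP => j; rewrite !mxE.
exists (\row_j (if j == ord0 then w 'i8_4 else w 'i8_5)).
exists (\row_j (if j == ord0 then w 'i8_6 else w 'i8_7)), 1.
rewrite scale1r phi_eval oner_neq0 !mk //; split=> //.
by rewrite row_mul; congr (_ *m _); apply/rowP => j; rewrite !mxE.
Qed.

Lemma chord_is_chord w : minor2 (point1 w) (point2 w) 'i6_0 'i6_1 != 0 ->
  is_chord (R4 phi) (chord_matrix w *m G).
Proof.
move=> m0; set L := _ *m G.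
(* The two rows are the points (1 : 0) and (0 : 1) of the line, the zeros of this quadratic form. *)
exists ('X_ord0 * 'X_ord_max); split=> [||d f hf vf].
- by rewrite -mpolyXD -msupp_eq0 msuppX.
- by rewrite -mpolyXD dhomogX /= mdegD !mdeg1.
have homogF : f \mPo line_param L \is (1 * d).-homog.
  by apply: comp_homog hf => i; apply: line_param_homog.
have evF i0 : (f \mPo line_param L).@[fun i => (i == i0)%:R] = 0.
  rewrite comp_mpoly_meval -(vf (row i0 L)); last exact: chord_R4.
  apply: meval_eq => i; rewrite line_param_eval mxE (bigD1 i0) //= eqxx mulr1.
  by rewrite big1 ?addr0 // => k /negPf ->; rewrite mulr0.
exact: divisible_X0X1 _ homogF (evF _) (evF _).
Qed.
End Chords.

(** The line is known to be a chord where the minor of [minor2_01] is nonzero. Multiplying by this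
    minor gives a polynomial that is zero at every [w], and the nonzero factor is then cancelled. *)
Lemma vanish_comp0 (K : numFieldType) phi (G : 'M[K]_6) (f : {mpoly K[15]}) :
    G \in unitmx -> (forall i, phi i = lin_comb G (@monomial12 K) i) ->
  vanishes_on (M4 phi) f -> f \mPo chord_form G = 0.
Proof.
move=> uG phiG vf.
have : (f \mPo chord_form G) * minor2 (point1 (vX K)) (point2 (vX K)) 'i6_0 'i6_1 = 0.
  apply: mpoly_vanish => w; rewrite mevalM.
  have -> : (minor2 (point1 (vX K)) (point2 (vX K)) 'i6_0 'i6_1).@[w] =
      minor2 (point1 w) (point2 w) 'i6_0 'i6_1.
    by rewrite !minor2_01 /ee !(mevalM, mevalB, mevalXU).
  have [->|m0] := eqVneq (minor2 (point1 w) (point2 w) 'i6_0 'i6_1) 0; first by rewrite mulr0.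
  rewrite comp_mpoly_meval.
  have -> : f.@[fun i => (tnth (chord_form G) i).@[w]] =
      f.@[plucker (chord_matrix w *m G) 0].
    by apply: meval_eq => k; apply: chord_form_eval.
  rewrite vf ?mul0r //; exists (chord_matrix w *m G); split=> //.
    exact: chord_rank.
  exact: chord_is_chord.
move=> /eqP; rewrite mulf_eq0 => /orP[/eqP //|]; rewrite minor2_01.
by rewrite !mulf_eq0 (negPf (ee_neq0 K)) -!msupp_eq0 !msuppX.
Qed.

(** The 2 x 2 minors of the matrix with rows [y_0 y_1 y_3 y_4] and [y_1 y_2 y_4 y_5]. *)
Definition quadrics : seq ('I_6 * 'I_6 * ('I_6 * 'I_6)) :=
  [:: ('i6_0, 'i6_2, ('i6_1, 'i6_1)); ('i6_0, 'i6_4, ('i6_1, 'i6_3));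
      ('i6_0, 'i6_5, ('i6_1, 'i6_4)); ('i6_1, 'i6_4, ('i6_2, 'i6_3));
      ('i6_1, 'i6_5, ('i6_2, 'i6_4)); ('i6_3, 'i6_5, ('i6_4, 'i6_4))].

Definition on_cone (A : comNzRingType) (y : 'I_6 -> A) : Prop :=
  forall a b c d, (a, b, (c, d)) \in quadrics -> y a * y b = y c * y d.

(** The differentials of the quadrics at [y], applied to [z]. *)
Definition on_tangent (A : comNzRingType) (y z : 'I_6 -> A) : Prop :=
  forall a b c d, (a, b, (c, d)) \in quadrics ->
    y a * z b + z a * y b = y c * z d + z c * y d.

(** The differential of [veronese] at [(s, t)] in the direction [(s', t')]. *)
Definition dveronese (A : comNzRingType) (s0 s1 t0 t1 s0' s1' t0' t1' : A) (i : 'I_6) : A :=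
  veronese s0' s1' t0 t1 i +
  nth 0 [:: s0; s1] (i %/ 3) *
    nth 0 [:: 2%:R * (t0 * t0'); t0 * t1' + t1 * t0'; 2%:R * (t1 * t1')] (i %% 3).

Lemma ord6P (P : 'I_6 -> Prop) : P 'i6_0 -> P 'i6_1 -> P 'i6_2 -> P 'i6_3 -> P 'i6_4 ->
  P 'i6_5 -> forall i, P i.
Proof.
move=> h0 h1 h2 h3 h4 h5 i.
case: i => -[|[|[|[|[|[|//]]]]]] lti;
  [move: h0 | move: h1 | move: h2 | move: h3 | move: h4 | move: h5];
  congr P; exact: val_inj.
Qed.

Lemma quadricsP (P : 'I_6 -> 'I_6 -> 'I_6 -> 'I_6 -> Prop) :
  P 'i6_0 'i6_2 'i6_1 'i6_1 -> P 'i6_0 'i6_4 'i6_1 'i6_3 -> P 'i6_0 'i6_5 'i6_1 'i6_4 ->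
  P 'i6_1 'i6_4 'i6_2 'i6_3 -> P 'i6_1 'i6_5 'i6_2 'i6_4 -> P 'i6_3 'i6_5 'i6_4 'i6_4 ->
  forall a b c d, (a, b, (c, d)) \in quadrics -> P a b c d.
Proof.
move=> h0 h1 h2 h3 h4 h5 a b c d; rewrite !inE.
by do ![case/orP]; move=> /eqP [-> -> -> ->].
Qed.

Lemma veronese_cone (A : comNzRingType) (s0 s1 t0 t1 : A) :
  on_cone (veronese s0 s1 t0 t1).
Proof. by apply: quadricsP; rewrite /veronese /=; ring. Qed.

(** * Points and tangent vectors of the affine cone over the surface *)

Section Cone.
Variable K : fieldType.

(** If y_0 or y_3 is nonzero, t_0 is scaled to 1 and t_1 is a ratio. Otherwise the quadrics force
    y_1 = y_4 = 0, and t = (0, 1). *)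
Lemma cone_param (y : 'I_6 -> K) : on_cone y -> (exists i, y i != 0) ->
  exists s0 s1 t0 t1, forall i, y i = veronese s0 s1 t0 t1 i.
Proof.
move=> cy nzy.
have h0 := cy 'i6_0 'i6_2 'i6_1 'i6_1 isT; have h1 := cy 'i6_0 'i6_4 'i6_1 'i6_3 isT.
have h2 := cy 'i6_0 'i6_5 'i6_1 'i6_4 isT; have h3 := cy 'i6_1 'i6_4 'i6_2 'i6_3 isT.
have h4 := cy 'i6_1 'i6_5 'i6_2 'i6_4 isT; have h5 := cy 'i6_3 'i6_5 'i6_4 'i6_4 isT.
have [y0|y0] := eqVneq (y 'i6_0) 0; last first.
  exists (y 'i6_0), (y 'i6_3), 1, (y 'i6_1 / y 'i6_0).
  have e2 := canRL (mulKf y0) h0; have e4 := canRL (mulKf y0) h1.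
  have e5 := canRL (mulKf y0) h2.
  by apply: ord6P; rewrite /veronese /= ?e5 ?e2 ?e4; field.
have [y3|y3] := eqVneq (y 'i6_3) 0; last first.
  exists (y 'i6_0), (y 'i6_3), 1, (y 'i6_4 / y 'i6_3).
  have e1 := canRL (mulfK y3) (esym h1); have e2 := canRL (mulfK y3) (esym h3).
  have e5 := canRL (mulKf y3) h5.
  by apply: ord6P; rewrite /veronese /= ?e5 ?e2 ?e1; field.
have y1 : y 'i6_1 = 0.
  by apply/eqP; move/eqP: h0; rewrite y0 mul0r eq_sym mulf_eq0 orbb.
have y4 : y 'i6_4 = 0.
  by apply/eqP; move/eqP: h5; rewrite y3 mul0r eq_sym mulf_eq0 orbb.
exists (y 'i6_2), (y 'i6_5), 0, 1.
by apply: ord6P; rewrite /veronese /= ?y0 ?y1 ?y3 ?y4; ring.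
Qed.

(** On each chart s_i t_j != 0 the differentiated quadrics determine three entries of [z] from the
    other three. These are matched by [s0'], [s1'] and one of [t0'], [t1']; the other is 0, as
    rescaling t is absorbed in s. *)
Lemma tangent_param (s0 s1 t0 t1 : K) (z : 'I_6 -> K) :
  (exists i, veronese s0 s1 t0 t1 i != 0) -> on_tangent (veronese s0 s1 t0 t1) z ->
  exists s0' s1' t0' t1', forall i, z i = dveronese s0 s1 t0 t1 s0' s1' t0' t1' i.
Proof.
move=> nz tz.
have := tz 'i6_0 'i6_2 'i6_1 'i6_1 isT; have := tz 'i6_0 'i6_4 'i6_1 'i6_3 isT.
have := tz 'i6_0 'i6_5 'i6_1 'i6_4 isT; have := tz 'i6_1 'i6_4 'i6_2 'i6_3 isT.
have := tz 'i6_1 'i6_5 'i6_2 'i6_4 isT; have := tz 'i6_3 'i6_5 'i6_4 'i6_4 isT.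
rewrite /veronese /= => h5 h4 h3 h2 h1 h0.
have [st00|st00] := eqVneq (s0 * t0) 0; last first.
  move: st00; rewrite mulf_eq0 negb_or => /andP[s00 t00].
  pose s0' := z 'i6_0 / (t0 * t0); pose s1' := z 'i6_3 / (t0 * t0).
  exists s0', s1', 0, ((z 'i6_1 - s0' * t0 * t1) / (s0 * t0)).
  have p0 : s0 * (t0 * t0) != 0 by rewrite !mulf_neq0.
  have e2 : z 'i6_2 = _ := canRL (mulKf p0) (canRL (addrK _) h0).
  have e4 : z 'i6_4 = _ := canRL (mulKf p0) (canRL (addrK _) h1).
  have e5 : z 'i6_5 = _ := canRL (mulKf p0) (canRL (addrK _) h2).
  by apply: ord6P; rewrite /dveronese /veronese /= ?e5 ?e4 ?e2 /s0' /s1'; field;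
     rewrite ?s00 ?t00.
have [st10|st10] := eqVneq (s1 * t0) 0; last first.
  move: st10; rewrite mulf_eq0 negb_or => /andP[s10 t00].
  pose s0' := z 'i6_0 / (t0 * t0); pose s1' := z 'i6_3 / (t0 * t0).
  exists s0', s1', 0, ((z 'i6_4 - s1' * t0 * t1) / (s1 * t0)).
  have p0 : s1 * (t0 * t0) != 0 by rewrite !mulf_neq0.
  have e5 : z 'i6_5 = _ := canRL (mulKf p0) (canRL (addrK _) h5).
  have e1 : z 'i6_1 = _ := canRL (mulfK p0) (canRL (addKr _) (esym h1)).
  have e2 : z 'i6_2 = _ := canRL (mulfK p0) (canRL (addKr _) (esym h3)).
  by apply: ord6P; rewrite /dveronese /veronese /= ?e5 ?e2 ?e1 /s0' /s1'; field;
     rewrite ?s10 ?t00.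
have [st01|st01] := eqVneq (s0 * t1) 0; last first.
  move: st01; rewrite mulf_eq0 negb_or => /andP[s00 t10].
  pose s0' := z 'i6_2 / (t1 * t1); pose s1' := z 'i6_5 / (t1 * t1).
  exists s0', s1', ((z 'i6_1 - s0' * t0 * t1) / (s0 * t1)), 0.
  have p0 : s0 * (t1 * t1) != 0 by rewrite !mulf_neq0.
  have e0 : z 'i6_0 = _ := canRL (mulfK p0) (canRL (addKr _) h0).
  have e4 : z 'i6_4 = _ := canRL (mulKf p0) (canRL (addrK _) (esym h4)).
  have e3 : z 'i6_3 = _ := canRL (mulKf p0) (canRL (addrK _) (esym h3)).
  by apply: ord6P; rewrite /dveronese /veronese /= ?e0 ?e3 ?e4 /s0' /s1'; field;
     rewrite ?s00 ?t10.
have [st11|st11] := eqVneq (s1 * t1) 0; last first.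
  move: st11; rewrite mulf_eq0 negb_or => /andP[s10 t10].
  pose s0' := z 'i6_2 / (t1 * t1); pose s1' := z 'i6_5 / (t1 * t1).
  exists s0', s1', ((z 'i6_4 - s1' * t0 * t1) / (s1 * t1)), 0.
  have p0 : s1 * (t1 * t1) != 0 by rewrite !mulf_neq0.
  have e3 : z 'i6_3 = _ := canRL (mulfK p0) (canRL (addKr _) h5).
  have e1 : z 'i6_1 = _ := canRL (mulfK p0) (canRL (addKr _) h4).
  have e0 : z 'i6_0 = _ := canRL (mulfK p0) (canRL (addKr _) h2).
  by apply: ord6P; rewrite /dveronese /veronese /= ?e0 ?e3 ?e1 /s0' /s1'; field;
     rewrite ?s10 ?t10.
case: nz; apply: ord6P; rewrite /veronese /= !mulrA ?st00 ?st10 ?st01 ?st11 ?mul0r ?eqxx //.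
all: by rewrite ?(mulrAC _ t0 t1) ?st01 ?st11 ?mul0r eqxx.
Qed.
End Cone.

(** * Splitting of binary quadratic forms *)

Lemma quadratic_form_coef (K : fieldType) (q : {mpoly K[2]}) : q \is 2.-homog ->
  exists A B C : K, q = A *: 'X_ord0 ^+ 2 + B *: ('X_ord0 * 'X_ord_max) + C *: 'X_ord_max ^+ 2.
Proof.
move=> hq; rewrite [q]mpolyE.
have : {subset msupp q <= msupp q} by [].
move: {1 3}(msupp q) => s; elim: s => [|m s IH] sq.
  by exists 0, 0, 0; rewrite big_nil !scale0r !addr0.
have [|A [B [C e]]] := IH; first by move=> x xs; apply: sq; rewrite inE xs orbT.
rewrite big_cons e; have := dhomog_mf hq (sq m (mem_head _ _)); rewrite /= mdegE.
rewrite mpolyXE_id !big_ord_recl !big_ord0 addn0 mulr1 /=.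
have -> : lift ord0 ord0 = ord_max :> 'I_2 by apply: val_inj.
case: (m ord0) => [|[|[|//]]] m1; have {m1} : m ord_max = _ := canRL (addKn _) m1;
  rewrite /= => ->.
- exists A, B, (q@_m + C); rewrite expr0 mul1r scalerDl; ring.
- exists A, (q@_m + B), C; rewrite !expr1 scalerDl; ring.
- exists (q@_m + A), B, C; rewrite expr0 mulr1 scalerDl; ring.
Qed.

Lemma quadratic_form_factor (K : numClosedFieldType) (q : {mpoly K[2]}) : q \is 2.-homog ->
  exists a0 a1 b0 b1 : K,
    q = (a0 *: 'X_ord0 + a1 *: 'X_ord_max) * (b0 *: 'X_ord0 + b1 *: 'X_ord_max).
Proof.
move=> /quadratic_form_coef[A [B [C ->]]].
have [->|A0] := eqVneq A 0.
  exists 0, 1, B, C; rewrite !scale0r !add0r scale1r mulrDr -!scalerAr expr2.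
  by rewrite ['X_ord_max * 'X_ord0]mulrC.
pose D := sqrtC (B ^+ 2 - 4%:R * A * C).
have D2 : D ^+ 2 = B ^+ 2 - 4%:R * A * C by rewrite sqrtCK.
exists A, ((B - D) / 2), 1, ((B + D) / (2 * A)).
have e1 : B = (B - D) / 2 + A * ((B + D) / (2 * A)) by field.
have e2 : C = (B - D) / 2 * ((B + D) / (2 * A)).
  have -> : (B - D) / 2 * ((B + D) / (2 * A)) = (B ^+ 2 - D ^+ 2) / (4%:R * A) by field.
  by rewrite D2; field.
rewrite {1}e1 {1}e2 scale1r; move: (_ / 2) (_ / (2 * A)) => u v.
by rewrite -!mul_mpolyC !rmorphD !rmorphM /=; ring.
Qed.

(** [plucker_form (minor2 x y)] is the Plücker vector of the line through [x G] and
    [y G]; taking any [M] in place of [minor2 x y] makes its linearity available. *)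
Section PluckerForm.
Variables (K S : comNzRingType) (h : {rmorphism K -> S}) (G : 'M[K]_6).

Definition plucker_form (M : 'I_6 -> 'I_6 -> S) (k : 'I_15) : S :=
  let: (i, j) := tnth plucker_index k in
  \sum_a \sum_b h (G a i) * h (G b j) * M a b.

Lemma plucker_formZ c M M' k : (forall a b, M a b = c * M' a b) ->
  plucker_form M k = c * plucker_form M' k.
Proof.
move=> e; rewrite /plucker_form; case: (tnth plucker_index k) => i j.
rewrite mulr_sumr; apply: eq_bigr => a _; rewrite mulr_sumr; apply: eq_bigr => b _.
by rewrite e mulrCA.
Qed.

Lemma plucker_form_minor2 (x y : 'I_6 -> S) k :
  plucker_form (minor2 x y) k = let: (i, j) := tnth plucker_index k in
  minor2 (fun a => \sum_b h (G b a) * x b) (fun a => \sum_b h (G b a) * y b) i j.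
Proof.
rewrite /plucker_form; case: (tnth plucker_index k) => i j.
have prodE a b u v : (\sum_k h (G k a) * u k) * (\sum_l h (G l b) * v l) =
    \sum_k \sum_l h (G k a) * h (G l b) * (u k * v l).
  rewrite mulr_suml; apply: eq_bigr => l _; rewrite mulr_sumr.
  by apply: eq_bigr => ? _; ring.
rewrite /minor2 !prodE [X in _ = _ - X]exchange_big -sumrB.
apply: eq_bigr => a _; rewrite -sumrB; apply: eq_bigr => b _; ring.
Qed.

End PluckerForm.

(** * Vanishing on secant and tangent lines *)

Section Vanishing.
Variables (K : fieldType) (G : 'M[K]_6) (d : nat) (f : {mpoly K[15]}).
Hypothesis hf : f \is d.-homog.
Hypothesis f0 : f \mPo chord_form G = 0.

Lemma chord_form_mmap (S : comNzRingType) (h : {rmorphism K -> S}) w k :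
  mmap h w (tnth (chord_form G) k) = plucker_form h G (minor2 (point1 w) (point2 w)) k.
Proof.
rewrite tnth_mktuple plucker_form_minor2; case: (tnth plucker_index k) => i j.
rewrite [LHS](minor2_morph (mmap h w)) /minor2 /=.
have e1 a : mmap h w (lin_comb G (point1 (vX K)) a) = \sum_b h (G b a) * point1 w b.
  rewrite raddf_sum; apply: eq_bigr => b _ /=; rewrite mmapZ; congr (_ * _).
  by rewrite [LHS](veronese_morph (mmap h w)) /= !mmapX !mmap1U.
have e2 a : mmap h w (lin_comb G (point2 (vX K)) a) = \sum_b h (G b a) * point2 w b.
  rewrite raddf_sum; apply: eq_bigr => b _ /=; rewrite mmapZ; congr (_ * _).
  by rewrite [LHS](veronese_morph (mmap h w)) /= !mmapX !mmap1U.
by congr (_ * _ - _ * _); [exact: e1 | exact: e2 | exact: e1 | exact: e2].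
Qed.

(** The identity [f0] can be specialized to points over any domain [S] over [K], and homogeneity
    turns the common factor [c] into [c ^+ d], which cancels. *)
Lemma vanish_of_scaled (S : idomainType) (h : {rmorphism K -> S}) w c M :
    c != 0 -> (forall a b, minor2 (point1 w) (point2 w) a b = c * M a b) ->
  mmap h (plucker_form h G M) f = 0.
Proof.
move=> c0 e; apply/eqP; suff : c ^+ d * mmap h (plucker_form h G M) f == 0.
  by rewrite mulf_eq0 expf_eq0 (negPf c0) andbF.
rewrite -(mmap_homog h c _ hf); apply/eqP.
transitivity (mmap h w (f \mPo chord_form G)); last by rewrite f0 raddf0.
rewrite mmap_comp; apply: eq_bigr => m _; congr (_ * _); apply: mmap1_eq => k.
by rewrite chord_form_mmap; apply/esym/plucker_formZ.
Qed.

Lemma plucker_mulmx (N : 'M[K]_(2, 6)) k :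
  plucker (N *m G) 0 k = plucker_form idfun G (minor2 (N 0) (N 1)) k.
Proof.
rewrite plucker_form_minor2 mxE; case: (tnth plucker_index k) => i j.
rewrite /minor2 !mxE; congr (_ * _ - _ * _); by apply: eq_bigr => a _; rewrite mulrC.
Qed.

Let pt8 (s0 s1 t0 t1 u0 u1 v0 v1 : K) : 'I_8 -> K :=
  fun i => nth 0 [:: s0; s1; t0; t1; u0; u1; v0; v1] i.

Lemma vanish_secant (N : 'M[K]_(2, 6)) s0 s1 t0 t1 u0 u1 v0 v1 c : c != 0 ->
    (forall a b, minor2 (veronese s0 s1 t0 t1) (veronese u0 u1 v0 v1) a b =
       c * minor2 (N 0) (N 1) a b) ->
  f.@[plucker (N *m G) 0] = 0.
Proof.
move=> c0 e.
rewrite -[RHS](vanish_of_scaled idfun (w := pt8 s0 s1 t0 t1 u0 u1 v0 v1) c0 e).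
by apply: meval_eq => k; apply: plucker_mulmx.
Qed.

(* The curve [w] over [{poly K}] moves the second point away from the first in the
   tangent direction; its minors are ['X] times a deformation of those at ['X = 0]. *)
Lemma vanish_tangent (N : 'M[K]_(2, 6)) s0 s1 t0 t1 s0' s1' t0' t1' c : c != 0 ->
    (forall a b, minor2 (veronese s0 s1 t0 t1) (dveronese s0 s1 t0 t1 s0' s1' t0' t1') a b =
       c * minor2 (N 0) (N 1) a b) ->
  f.@[plucker (N *m G) 0] = 0.
Proof.
move=> c0 e.
pose w (i : 'I_8) : {poly K} := nth 0
  [:: s0%:P; s1%:P; t0%:P; t1%:P; s0%:P + s0'%:P * 'X; s1%:P + s1'%:P * 'X;
      t0%:P + t0'%:P * 'X; t1%:P + t1'%:P * 'X] i.
(* The part of the second point divisible by ['X ^+ 2], after division; it drops out at ['X = 0]. *)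
pose R (i : 'I_6) : {poly K} :=
  nth 0 [:: s0'%:P; s1'%:P] (i %/ 3) *
    nth 0 [:: 2%:R * (t0%:P * t0'%:P); t0%:P * t1'%:P + t1%:P * t0'%:P; 2%:R * (t1%:P * t1'%:P)] (i %% 3)
  + (nth 0 [:: s0%:P; s1%:P] (i %/ 3) + 'X * nth 0 [:: s0'%:P; s1'%:P] (i %/ 3)) *
    nth 0 [:: t0'%:P * t0'%:P; t0'%:P * t1'%:P; t1'%:P * t1'%:P] (i %% 3).
have p1 a : point1 w a = (veronese s0 s1 t0 t1 a)%:P.
  by rewrite [RHS](veronese_morph polyC).
have p2 a : point2 w a = (veronese s0 s1 t0 t1 a)%:P +
    'X * (dveronese s0 s1 t0 t1 s0' s1' t0' t1' a)%:P + 'X ^+ 2 * R a.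
  move: a; apply: ord6P; rewrite /point2 /veronese /dveronese /veronese /R /w /= !(polyCD, polyCM); ring.
pose P := veronese s0 s1 t0 t1.
pose Q := dveronese s0 s1 t0 t1 s0' s1' t0' t1'.
pose M a b : {poly K} := (minor2 P Q a b)%:P + 'X * minor2 (fun i => (P i)%:P) R a b.
have e' a b : minor2 (point1 w) (point2 w) a b = 'X * M a b.
  by rewrite /M /minor2 !p1 !p2 -/(P _) -/(P _) -/(Q _) -/(Q _) polyCB !polyCM; ring.
have X0 : ('X : {poly K}) != 0 by rewrite polyX_eq0.
have /(congr1 (horner_eval 0)) := vanish_of_scaled polyC X0 e'.
rewrite /horner_eval horner0 => vM.
have vPQ : f.@[plucker_form idfun G (minor2 P Q)] = 0.
  rewrite -[RHS]vM horner_sum; apply: eq_bigr => m _.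
  rewrite hornerM hornerC horner_prod; congr (_ * _); apply: eq_bigr => k _.
  rewrite horner_exp; congr (_ ^+ _).
  rewrite /plucker_form; case: (tnth plucker_index k) => i j.
  rewrite horner_sum; apply: eq_bigr => a _; rewrite horner_sum; apply: eq_bigr => b _.
  by rewrite !hornerM !hornerC /M hornerD hornerC hornerM hornerX mul0r addr0.
apply/eqP; suff : c ^+ d * f.@[plucker (N *m G) 0] == 0.
  by rewrite mulf_eq0 expf_eq0 (negPf c0) andbF.
rewrite -(mmap_homog idfun c _ hf) -[X in _ == X]vPQ; apply/eqP/meval_eq => k.
by rewrite plucker_mulmx; apply/esym/plucker_formZ.
Qed.
End Vanishing.

(** * From the scheme-theoretic chord condition to secants and tangents *)

Section ChordVanishing.
Variable K : numClosedFieldType.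
Variables (phi : 'I_6 -> {mpoly K[2 + 2]}) (G : 'M[K]_6).
Hypothesis uG : G \in unitmx.
Hypothesis phiG : forall i, phi i = lin_comb G (@monomial12 K) i.

(** The linear forms on P^5 in which the surface becomes [veronese]; [Z] gives their restrictions to
    a line. *)
Let Y j : {mpoly K[6]} := \sum_i invmx G i j *: 'X_i.
Let Z (N : 'M[K]_(2, 6)) j : {mpoly K[2]} := \sum_k N k j *: 'X_k.

Lemma quadric_vanish a b c e : (a, b, (c, e)) \in quadrics ->
  vanishes_on (R4 phi) (Y a * Y b - Y c * Y e).
Proof.
move=> abce x [s [t [k [_ _ _ ->]]]].
set v := \row_j veronese (s 0 ord0) (s 0 ord_max) (t 0 ord0) (t 0 ord_max) j.
have Yv j : (Y j).@[(k *: \row_i (phi i).@[row_mx s t 0]) 0] = k * v 0 j.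
  transitivity ((k *: (v *m G) *m invmx G) 0 j); last first.
    by rewrite -scalemxAl mulmxK // mxE.
  rewrite (phi_eval phiG) mxE raddf_sum; apply: eq_bigr => i _ /=.
  by rewrite mevalZ mevalXU mulrC.
rewrite mevalB !mevalM !Yv !mxE.
have := @veronese_cone K (s 0 ord0) (s 0 ord_max) (t 0 ord0) (t 0 ord_max) a b c e abce.
by move: (veronese _ _ _ _) => V h; rewrite mulrACA h; ring.
Qed.

Lemma Y_line_param L j : Y j \mPo line_param L = Z (L *m invmx G) j.
Proof.
rewrite /Y /Z raddf_sum /=.
under eq_bigr => i _ do rewrite comp_mpolyZ comp_mpolyXU -tnth_nth tnth_mktuple scaler_sumr.
rewrite exchange_big; apply: eq_bigr => k _; rewrite mxE scaler_suml.
by apply: eq_bigr => i _; rewrite scalerA mulrC.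
Qed.

Lemma chord_quadric L q a b c e :
    (forall (d : nat) (f : {mpoly K[6]}), f \is d.-homog -> vanishes_on (R4 phi) f ->
       exists g, f \mPo line_param L = g * q) ->
    (a, b, (c, e)) \in quadrics -> let N := L *m invmx G in
  exists g, Z N a * Z N b - Z N c * Z N e = g * q.
Proof.
move=> hq abce N.
have Yh j : Y j \is 1.-homog.
  by apply: rpred_sum => i _; rewrite rpredZ // dhomogX /= mdeg1.
have [|g hg] := hq 2 _ _ (quadric_vanish abce).
  by rewrite rpredB //; apply: dhomogM (Yh _) (Yh _).
exists g; rewrite -hg -[RHS]/(comp_mpoly _ _) rmorphB !rmorphM /=.
by rewrite !Y_line_param.
Qed.

Lemma Z_deriv N i j : (Z N j)^`M(i) = (N i j)%:MP.
Proof.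
have dX k : ('X_k : {mpoly K[2]})^`M(i) = (k == i)%:R.
  rewrite mderivX mnm1E; case: eqP => [->|_]; last by rewrite scale0r.
  have -> : (U_(i) - U_(i) = 0 :> 'X_{1..2})%MM.
    by apply/mnmP => l; rewrite mnmBE mnm0E subnn.
  by rewrite scale1r mpolyX0.
rewrite /Z raddf_sum (bigD1 i) //= mderivZ dX eqxx big1 => [|k ki]; last first.
  by rewrite mderivZ dX (negPf ki) scaler0.
by rewrite addr0 -mul_mpolyC mulr1.
Qed.

Variables (d : nat) (f : {mpoly K[15]}).
Hypothesis hf : f \is d.-homog.
Hypothesis f0 : f \mPo chord_form G = 0.

Lemma chord_vanish L : \rank L = 2%N -> is_chord (R4 phi) L -> f.@[plucker L 0] = 0.
Proof.
move=> rL [q [q0 /quadratic_form_factor[a0 [a1 [b0 [b1 qE]]]] hq]].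
have {hq} hq := chord_quadric hq; pose N := L *m invmx G.
have LN : L = N *m G by rewrite mulmxKV.
have freeN : row_free N.
  by rewrite /row_free mxrankMfree ?rL // row_free_unit unitmx_inv.
(* [rho c0 c1] is the zero of [c0 *: 'X_ord0 + c1 *: 'X_ord_max], and [P c0 c1] is the corresponding
   point of the line in standard coordinates. *)
pose P (c0 c1 : K) j := c1 * N 0 j - c0 * N 1 j.
pose rho (c0 c1 : K) (i : 'I_2) := if i == 0 then c1 else - c0.
have evZ c0 c1 j : (Z N j).@[rho c0 c1] = P c0 c1 j.
  rewrite raddf_sum big_ord_recl big_ord1 /= !mevalZ !mevalXU /P /rho /=.
  have -> : lift ord0 ord0 = 1 :> 'I_2 by apply: val_inj.
  by ring.
have evl c0 c1 u0 u1 : (u0 *: 'X_ord0 + u1 *: 'X_ord_max).@[rho c0 c1] = u0 * c1 - u1 * c0.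
  by rewrite mevalD !mevalZ !mevalXU /rho /= mulrN.
have nzP c0 c1 : (c0 != 0) || (c1 != 0) -> exists i, P c0 c1 i != 0.
  move=> nzc; apply/existsP; apply: contraTT nzc; rewrite negb_exists => /forallP P0.
  pose v : 'rV[K]_2 := \row_i rho c0 c1 i.
  have : v *m N == 0.
    apply/eqP/rowP => j; transitivity ((Z N j).@[rho c0 c1]); last first.
      by rewrite evZ mxE; have /negPn/eqP := P0 j.
    rewrite mxE /Z raddf_sum; apply: eq_bigr => i _ /=.
    by rewrite mevalZ mevalXU mxE mulrC.
  rewrite mulmx_free_eq0 // => /eqP/rowP v0.
  have := v0 0; have := v0 1; rewrite !mxE /rho /= => /eqP; rewrite oppr_eq0 => /eqP -> ->.
  by rewrite eqxx.
have coneP c0 c1 : q.@[rho c0 c1] = 0 -> on_cone (P c0 c1).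
  move=> qr a b c e /hq[g /(congr1 (meval (rho c0 c1)))].
  by rewrite mevalM qr mulr0 mevalB !mevalM !evZ => /eqP; rewrite subr_eq0 => /eqP.
have nza : (a0 != 0) || (a1 != 0).
  rewrite -negb_and; apply: contra q0 => /andP[/eqP e0 /eqP e1].
  by rewrite qE e0 e1 !scale0r addr0 mul0r.
have nzb : (b0 != 0) || (b1 != 0).
  rewrite -negb_and; apply: contra q0 => /andP[/eqP e0 /eqP e1].
  by rewrite qE e0 e1 !scale0r addr0 mulr0.
have ca : on_cone (P a0 a1).
  by apply: coneP; rewrite qE mevalM !evl; ring.
have cb : on_cone (P b0 b1).
  by apply: coneP; rewrite qE mevalM !evl; ring.
have [s0 [s1 [t0 [t1 Pa]]]] := cone_param ca (nzP _ _ nza).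
(* The resultant of the two linear factors: if nonzero, the line is spanned by the two roots, and it
   is also the factor between the two sets of minors. *)
have [D0|D0] := eqVneq (a0 * b1 - a1 * b0) 0; last first.
  have [u0 [u1 [v0 [v1 Pb]]]] := cone_param cb (nzP _ _ nzb).
  rewrite LN; apply: (vanish_secant hf f0 (s0 := s0) (s1 := s1) (t0 := t0) (t1 := t1)
    (u0 := u0) (u1 := u1) (v0 := v0) (v1 := v1) D0) => i j.
  by rewrite /minor2 -!Pa -!Pb /P; ring.
(* At the double root the partial derivatives of every multiple of [q] vanish; for the restricted
   quadrics they are the tangency equations on the rows of [N]. *)
have tan i : on_tangent (P a0 a1) (N i).
  have double_root g (l1 l2 : {mpoly K[2]}) :
      l1.@[rho a0 a1] = 0 -> l2.@[rho a0 a1] = 0 -> (g * (l1 * l2))^`M(i).@[rho a0 a1] = 0.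
    by move=> l10 l20; rewrite !mderivM !(mevalD, mevalM) l10 l20; ring.
  move=> a b c e /hq[g /(congr1 (fun p => p^`M(i).@[rho a0 a1]))].
  rewrite qE double_root ?evl; [|ring|by rewrite -oppr0 -D0; ring].
  rewrite mderivB !mderivM !Z_deriv !(mevalB, mevalD, mevalM) !mevalC !evZ.
  by move=> /eqP; rewrite subr_eq0 addrC [X in _ == X]addrC => /eqP h; rewrite ![N i _ * _]mulrC in h *.
have tanV i : on_tangent (veronese s0 s1 t0 t1) (N i).
  by move=> a b c e /tan; rewrite !Pa.
have nzV : exists i, veronese s0 s1 t0 t1 i != 0.
  by have [k hk] := nzP _ _ nza; exists k; rewrite -Pa.
(* The minors of [P a0 a1] with row 0 of [N] are [a0] times those of [N], and with row 1 they are
   [a1] times; a row with nonzero factor serves as tangent direction. *)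
rewrite LN; case/orP: nza => c0.
  have [s0' [s1' [t0' [t1' N0]]]] := tangent_param nzV (tanV 0).
  apply: (vanish_tangent hf f0 (s0 := s0) (s1 := s1) (t0 := t0) (t1 := t1)
    (s0' := s0') (s1' := s1') (t0' := t0') (t1' := t1') c0) => i j.
  by rewrite /minor2 -!N0 -!Pa /P; ring.
have [s0' [s1' [t0' [t1' N1]]]] := tangent_param nzV (tanV 1).
apply: (vanish_tangent hf f0 (s0 := s0) (s1 := s1) (t0 := t0) (t1 := t1)
  (s0' := s0') (s1' := s1') (t0' := t0') (t1' := t1') c0) => i j.
by rewrite /minor2 -!N1 -!Pa /P; ring.
Qed.
End ChordVanishing.

Lemma vanishes_on_M4 (K : numClosedFieldType) phi (G : 'M[K]_6) d (f : {mpoly K[15]}) :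
    G \in unitmx -> (forall i, phi i = lin_comb G (@monomial12 K) i) -> f \is d.-homog ->
  vanishes_on (M4 phi) f <-> f \mPo chord_form G = 0.
Proof.
move=> uG phiG hf; split; first exact: vanish_comp0.
by move=> f0 _ [L [rL cL ->]]; exact: (chord_vanish uG phiG hf f0 rL cL).
Qed.

(** Substituting [chord_form G] has the ideal of [M4 phi] in degree [d] as kernel and the span of
    the products [bas] as image, so the Hilbert function counts [indices d]. *)
Lemma degree_M4 (K : numClosedFieldType) (phi : 'I_6 -> {mpoly K[2 + 2]}) :
  basis_H0_1_2 phi -> has_degree (M4 phi) 22%N.
Proof.
move=> /basis_coords[G uG phiG].
have two_neq0 : (2 : K) != 0 by rewrite pnatr_eq0.
exists hilbert_poly22; last exact: hilbert_poly22_lead.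
(* Hilbert function and polynomial agree from degree 0 on. *)
exists 0%N => d _; exists (size (indices d)); last exact: hilbert_poly22E.
pose I := 'I_(size (indices d)).
pose i0 : basis_index := (0, ((0, 0), (false, 0)))%N.
pose idx (i : I) := nth i0 (indices d) i.
have big_idx (c : basis_index -> K) : \sum_(i <- indices d) c i *: bas (vX K) d i =
    \sum_(i : I) c (idx i) *: bas (vX K) d (idx i).
  by rewrite (big_nth i0) big_mkord.
have idx_in i : idx i \in indices d by rewrite mem_nth.
have exF (i : I) : exists p : dhomog 15 K d, p \mPo chord_form G = bas (vX K) d (idx i).
  have [p hp e] := bas_in_image uG (idx_in i).
  by exists (DHomog hp).
have [F hF] := fin_all_exists exF.
pose ev (p : dhomog 15 K d) := (p : {mpoly K[15]}) \mPo chord_form G.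
have ev_lin : linear ev by move=> a u v; rewrite /ev /= !linearP.
pose evl : {linear dhomog 15 K d -> {mpoly K[8]}} :=
  HB.pack ev (GRing.isLinear.Build _ _ _ _ ev ev_lin).
have [p|c hc|U [hU dimU]] := kernel_dim (f := evl) (F := F).
- have [|c e] := image_in_span (d := d) (p := evl p) (fun k => chord_form_in_span G k two_neq0).
    by exists p => //; apply: dhomog_is_dhomog.
  exists (\row_i c (idx i)); rewrite e big_idx; apply: eq_bigr => i _.
  by rewrite mxE /= /ev hF.
- apply/rowP => i; rewrite mxE.
  (* Transports the coefficients from positions in [indices d] to the indices themselves. *)
  pose c' (x : basis_index) := nth 0 [seq c 0 j | j <- enum 'I_(size (indices d))] (index x (indices d)).
  have c'E j : c' (idx j) = c 0 j.
    rewrite /c' index_uniq ?uniq_indices // (nth_map i) ?size_enum_ord //.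
    by congr (c 0 _); apply: val_inj; rewrite /= nth_enum_ord.
  rewrite -c'E; apply: (bas_free two_neq0 _ (idx_in i)); rewrite big_idx -[RHS]hc.
  by apply: eq_bigr => j _; rewrite c'E /= /ev hF.
exists U; split=> // p; rewrite hU.
by split=> /(vanishes_on_M4 uG phiG (dhomog_is_dhomog p)).
Qed.

Local Close Scope ring_scope.

Theorem proposition2p6 (R : realType) (phi : 'I_6 -> {mpoly R[i][(2 + 2)]})
    (hphi : basis_H0_1_2 phi) :
  has_degree (M4 phi) 22.
Proof. exact: degree_M4. Qed.
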